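(* Let $f\in C^3(0,\infty)$ satisfy $f(x)>0$, $f'(x)>0$, and, as $x\to\infty$, (i) $f(x)\to\infty$; (ii) $\dfrac{f'(x)}{f(x)}\to0$; (iii) $\dfrac{f''(x)/f'(x)}{f'(x)/f(x)}=O(1)$; (iv) $\dfrac{f'''(x)f(x)^2}{f'(x)^3}=O(1)$. Let $\alpha=\{a_j\}_{j=1}^\infty=\{1/f(j)\}_{j=1}^\infty$, $A_N=\sum_{j=1}^Na_j$, and let $T_m(N)$ be the coupon-collector variable with coupon probabilities $p_j=a_j/A_N$, $1\le j\le N$. Then for all positive integers $m$, as $N\to\infty$, $$V[T_m(N)]\sim\frac{\pi^2}{6}A_N^2f(N)^2=\frac{\pi^2}{6}\cdot\frac1{p_N^2}=\frac{\pi^2}{6}\cdot\frac{1}{\min_{1\le j\le N}\{p_j\}^2}.$$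
   Context: Coupon collector setting: coupons of $N$ types are drawn independently with replacement, type $j$ having probability $p_j>0$, $\sum_{j=1}^Np_j=1$. $T_m(N)$ is the number of draws needed until every one of the $N$ types has been drawn at least $m$ times. $V$ denotes variance. $x_N\sim y_N$ means $x_N/y_N\to1$ as $N\to\infty$. *)

(* Defs.v *)
From HB Require Import structures.
From mathcomp Require Import all_boot all_order all_algebra.
From mathcomp Require Import all_classical all_reals all_analysis.

Set Implicit Arguments.
Unset Strict Implicit.
Unset Printing Implicit Defensive.

Import Order.TTheory GRing.Theory Num.Theory.
Import numFieldNormedType.Exports.

Local Open Scope classical_set_scope.
Local Open Scope ring_scope.

(* Only the values of f on ]0, +oo[ matter: at x > 0 the iterated derivatives
   depend only on the germ of f at x. *)
Definition C3_pos (R : realType) (f : R -> R) : Prop :=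
  (forall (k : nat) (x : R), (k < 3)%N -> 0 < x -> derivable (derive1n k f) x 1) /\
  (forall x : R, 0 < x -> {for x, continuous (derive1n 3 f)}).

Definition pinfty_filter (R : realType) : filter_on R :=
  FilterType (pinfty_nbhs R) _.

Definition mutually_independent (d d' : measure_display)
    (Omega : measurableType d) (S : measurableType d') (R : realType)
    (P : probability Omega R) (X : nat -> {RV P >-> S}) : Prop :=
  forall (s : seq nat) (B : nat -> set S),
    uniq s -> (forall i, measurable (B i)) ->
    P (\bigcap_(i in [set` s]) (X i @^-1` B i)) =
    (\prod_(i <- s) P (X i @^-1` B i))%E.

(* X k is the type, among 1, ..., N, of the (k+1)-st coupon drawn.  When the
   p j (1 <= j <= N) sum to 1, each X k lies in {1, ..., N} almost surely. *)
Definition coupon_draws (d : measure_display) (Omega : measurableType d)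
    (R : realType) (P : probability Omega R) (N : nat) (p : nat -> R)
    (X : nat -> {RV P >-> nat}) : Prop :=
  mutually_independent X /\
  (forall k j : nat, (1 <= j <= N)%N -> P (X k @^-1` [set j]) = (p j)%:E).

Definition complete (m N : nat) (x : nat -> nat) (n : nat) : bool :=
  all (fun j => m <= \sum_(k < n) (x k == j))%N (iota 1 N).

(* The value 0 is a default on the null event that the collection is never
   completed. *)
Definition completion_time (m N : nat) (x : nat -> nat) : nat :=
  match pselect (exists n, complete m N x n) with
  | left h => ex_minn h
  | right _ => 0%N
  end.

Definition collector_time (d : measure_display) (Omega : measurableType d)
    (R : realType) (P : probability Omega R) (m N : nat)
    (X : nat -> {RV P >-> nat}) (w : Omega) : R :=
  (completion_time m N (fun k => X k w))%:R.

Definition weight (R : realType) (f : R -> R) (j : nat) : R := (f j%:R)^-1.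

Definition weight_sum (R : realType) (f : R -> R) (N : nat) : R :=
  \sum_(1 <= j < N.+1) weight f j.

Definition coupon_prob (R : realType) (f : R -> R) (N j : nat) : R :=
  weight f j / weight_sum f N.

(* The default p 1 is one of the terms as soon as N >= 1. *)
Definition min_prob (R : realType) (N : nat) (p : nat -> R) : R :=
  \big[Num.min/p 1%N]_(1 <= j < N.+1) p j.

Definition asymptotic_to (R : realType) (u : nat -> \bar R) (v : nat -> R) :
    Prop :=
  (fun N => (u N * ((v N)^-1)%:E)%E) @ \oo --> (1%:E : \bar R).

(* Main.v *)
(** Poissonization: if coupons arrive at the times of a unit Poisson process,
    the completion time is a maximum of independent Gamma(m, p_j) variables, and
    E[T] and E[T(T+1)] are the first two moments of that maximum.  Rescaling by
    1/p_N, its distribution function is F_N(s) = prod_j (1 - Q(s r_j)), where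
    r_j = f(N)/f(j) >= 1 and Q(u) is the probability that a Poisson variable of
    mean u is smaller than m.  Choose c_N with h_N(c_N) = 1, where
    h_N(s) = sum_j Q(s r_j).  Since g = f/f' is Lipschitz near infinity by (iii),
    the r_j are spread on the scale g(N), which tends to infinity by (ii), so
    that h_N is dominated by the j with r_j near 1, where Q((s + x) r_j) is close
    to exp(-x) Q(s r_j).  Hence h_N(c_N + x) -> exp(-x) and
    F_N(c_N + x) -> exp(-exp(-x)), the Gumbel distribution function, with
    integrable tails uniformly in N; so the variance converges to that of the
    Gumbel law.  The same argument applied to the maximum of n independent
    exponential variables, whose variance is 1 + 1/4 + ... + 1/n^2, identifies
    the limit as pi^2/6. *)
Require Import Defs.
From HB Require Import structures.
From mathcomp Require Import all_boot all_order all_algebra.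
From mathcomp Require Import all_classical all_reals all_analysis.
From mathcomp Require Import measurable_realfun.
From mathcomp Require Import ring lra zify.

Set Implicit Arguments.
Unset Strict Implicit.
Unset Printing Implicit Defensive.

Import Order.TTheory GRing.Theory Num.Theory.
Import numFieldNormedType.Exports.

Local Open Scope classical_set_scope.
Local Open Scope ring_scope.

(** The variance is a difference of two quantities of order c_N^2, and c_N is unbounded, so
    equivalents of E[T] and E[T(T+1)] taken separately would not determine it. Centring at c_N makes
    a limit possible: with M1 and M2 the integrals of 1 - F_N(s) and s (1 - F_N(s)) over the half
    line, 2 M2 - M1^2 is invariant under translation, and only centred integrals have to converge.
    In units of 1/p_N the variance is 2 M2 - M1^2 - M1 p_N; the last term comes from E[T(T+1)] -
    E[T] - E[T]^2 and vanishes because 1/p_N >= N and c_N = o(N). No Poisson process is constructed: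
    Poissonization is an identity between exponential generating functions, integrated term by term
    against Gamma densities. The spread of the r_j follows from a differential inequality: if g is
    C-Lipschitz beyond a threshold, the type N - k above it has r^C >= 1 + C k / g(N). Once the
    decay of Q has absorbed a power of r, distant types contribute at most in proportion to (1 + k /
    g(N))^-2, whose sum is of order g(N). *)

Lemma derive_ge0_le (R : realType) (f df : R -> R) (a b : R) : a <= b ->
  (forall x, a <= x <= b -> is_derive x 1 f (df x)) ->
  (forall x, a <= x <= b -> 0 <= df x) -> f a <= f b.
Proof.
move=> ab dfE df0.
have [||c cab fE] := @MVT_segment R f df a b ab.
- by move=> x; rewrite in_itv/= => /andP[ax xb]; apply: dfE; rewrite !ltW.
- apply: derivable_within_continuous => x; rewrite in_itv/= => xab; have dx := dfE _ xab.
  exact: ex_derive.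
- by rewrite -subr_ge0 fE mulr_ge0 ?subr_ge0// df0.
Qed.

(** * The sum of the inverse squares *)

Section basel.
Context {R : realType}.
Implicit Types x : R.

Lemma sin_le_id x : 0 <= x -> sin x <= x.
Proof.
move=> x0; rewrite -subr_ge0.
have -> : 0 = id 0 - sin 0 :> R by rewrite sin0 subr0.
apply: (@derive_ge0_le _ (fun y => id y - sin y) (fun y => 1 - cos y)) => // y _; rewrite ?subr_ge0 ?cos_le1//.
Qed.

Lemma mul_cos_le_sin x : 0 <= x <= pi -> x * cos x <= sin x.
Proof.
move=> /andP[x0 xpi]; rewrite -subr_ge0.
have -> : 0 = sin 0 - id 0 * cos 0 :> R by rewrite sin0 mul0r subr0.
apply: (@derive_ge0_le _ (fun y => sin y - id y * cos y)
  (fun y => y * sin y)) => // y /andP[y0 yx].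
  by apply: is_derive_eq; rewrite /GRing.scale/=; ring.
by rewrite mulr_ge0// sin_ge0_pi// y0 (le_trans yx).
Qed.

(** Squaring x cos x <= sin x gives x^2 <= (1 + x^2) sin^2 x, which is the upper bound. An error
    that is merely bounded suffices: the sums below have 2^n terms and are rescaled by a multiple of
    4^-n. *)
Lemma sinV2_bounds x : 0 < x < pi / 2 ->
  x ^- 2 <= (sin x) ^- 2 <= x ^- 2 + 1.
Proof.
move=> /andP[x0 xpi].
have xpi' : x <= pi by rewrite (le_trans (ltW xpi))// ler_pdivrMr// ler_peMr ?pi_ge0 ?ler1n.
have s0 : 0 < sin x by rewrite sin_gt0_pihalf ?x0.
have c0 : 0 < cos x by rewrite cos_gt0_pihalf// xpi andbT (lt_trans _ x0)// oppr_lt0 divr_gt0 ?pi_gt0.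
have sx := sin_le_id (ltW x0).
have cs : x * cos x <= sin x by rewrite mul_cos_le_sin ?(ltW x0).
have sin2 : sin x ^+ 2 = 1 - cos x ^+ 2 by rewrite sin2cos2.
apply/andP; split.
  by rewrite lef_pV2 ?posrE ?exprn_gt0// lerXn2r// nnegrE ltW.
have -> : x ^- 2 + 1 = (1 + x ^+ 2) / x ^+ 2 by field; rewrite gt_eqF.
rewrite -[leLHS]mul1r ler_pdivrMr ?exprn_gt0// mulrAC ler_pdivlMr ?exprn_gt0// mul1r.
have : (x * cos x) ^+ 2 <= sin x ^+ 2 by rewrite lerXn2r// nnegrE ?mulr_ge0// ltW.
rewrite exprMn (cos2sin2 x) => h; nra.
Qed.

(** The angles are the odd multiples of pi / 2^(n+2) in the first quadrant, so that the summands
    imitate multiples of the odd inverse squares. *)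
Definition sinV2_sum (n : nat) : R :=
  \sum_(k < 2 ^ n) (sin ((k.*2.+1)%:R * (pi / (2 ^ n.+2)%:R))) ^- 2.

Lemma sinV2_halve x : 0 < x < pi / 2 ->
  (sin x) ^- 2 + (sin (pi / 2 - x)) ^- 2 = 4 * (sin (x *+ 2)) ^- 2.
Proof.
move=> /andP[x0 xpi].
have s0 : 0 < sin x by rewrite sin_gt0_pihalf ?x0.
have c0 : 0 < cos x by rewrite cos_gt0_pihalf// xpi andbT (lt_trans _ x0)// oppr_lt0 divr_gt0 ?pi_gt0.
have -> : sin (pi / 2 - x) = cos x by rewrite sinB sin_pihalf cos_pihalf; ring.
rewrite sin_mulr2n.
have sc := cos2Dsin2 x.
have -> : (sin x) ^- 2 + (cos x) ^- 2 = (cos x ^+ 2 + sin x ^+ 2) / (cos x ^+ 2 * sin x ^+ 2).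
  by field; rewrite !gt_eqF.
by rewrite sc; field; rewrite !gt_eqF.
Qed.

Lemma sinV2_angle (n k : nat) : (k < 2 ^ n)%N ->
  0 < (k.*2.+1)%:R * ((pi : R) / (2 ^ n.+2)%:R) < (pi : R) / 2.
Proof.
move=> kn; rewrite mulr_gt0 ?divr_gt0 ?pi_gt0 ?ltr0n ?expn_gt0//=.
rewrite mulrCA ltr_pM2l ?pi_gt0// ltr_pdivrMr ?ltr0n ?expn_gt0//.
rewrite mulrC ltr_pdivlMr// -natrM ltr_nat !expnS; lia.
Qed.

(* The angles k and 2^(n+1) - 1 - k are complementary, so sinV2_halve pairs
   their terms into 4 times a term of the previous sum. *)
Lemma sinV2_sumE n : sinV2_sum n = 2 * 4 ^+ n.
Proof.
elim: n => [|n IHn].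
  rewrite /sinV2_sum big_ord1 expr0 mulr1/= mul1r.
  have h : 0 < (pi : R) / 4 < (pi : R) / 2.
    have := pi_gt0 R; by move=> p0; apply/andP; split; lra.
  have := sinV2_halve h.
  have -> : pi / 2 - pi / 4 = pi / 4 :> R by field.
  have -> : (pi / 4) *+ 2 = pi / 2 :> R by field.
  rewrite sin_pihalf expr1n invr1 (_ : (2 ^ 2)%N = 4%N)//; lra.
rewrite exprS mulrCA -IHn /sinV2_sum.
rewrite [in LHS](_ : (2 ^ n.+1 = 2 ^ n + 2 ^ n)%N); last by rewrite expnS mul2n addnn.
rewrite big_split_ord/= [X in _ + X](reindex_inj rev_ord_inj)/=.
rewrite -big_split/= mulr_sumr; apply: eq_bigr => k _.
have k2 := sinV2_angle (leq_trans (ltn_ord k) (leq_pexp2l (isT : (0 < 2)%N) (leqnSn n))).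
set t := (k.*2.+1)%:R * (pi / (2 ^ n.+3)%:R) : R in k2 *.
have p2 : (2 ^ n)%:R != 0 :> R by rewrite pnatr_eq0 -lt0n expn_gt0.
have -> : (k.*2.+1)%:R * (pi / (2 ^ n.+2)%:R) = t *+ 2 :> R.
  by rewrite /t !expnS !natrM; field.
rewrite -sinV2_halve//; congr (_ + (sin _) ^- 2).
rewrite /t.
have -> : (2 ^ n + (2 ^ n - k.+1)).*2.+1 = (4 * 2 ^ n - k.*2.+1)%N.
  by have := ltn_ord k; lia.
rewrite natrB; last by have := ltn_ord k; lia.
by rewrite !expnS !natrM; field.
Qed.

Definition odd_inv_sq (n : nat) : R := \sum_(k < n) ((k.*2.+1)%:R ^+ 2)^-1.

(** With c = pi / 2^(n+2), the closed form of [sinV2_sum] contributes c^2 * 2 * 4^n = pi^2 / 8, and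
    the 2^n errors of size at most 1 contribute c^2 * 2^n = pi^2 / 16 * 2^-n. *)
Lemma odd_inv_sq_bounds n :
  pi ^+ 2 / 8 - pi ^+ 2 / 16 * 2 ^- n <= odd_inv_sq (2 ^ n) <= pi ^+ 2 / 8.
Proof.
pose c : R := pi / (2 ^ n.+2)%:R.
have pi0 := pi_gt0 R.
have n0 : (0 : R) < 2 ^+ n by rewrite exprn_gt0.
have c0 : 0 < c by rewrite divr_gt0 ?pi_gt0 ?ltr0n ?expn_gt0.
have cE : c ^+ 2 = pi ^+ 2 / 16 / (2 ^+ n) ^+ 2.
  by rewrite /c natrX !exprS expr0; field; rewrite gt_eqF.
have oE : odd_inv_sq (2 ^ n) =
    c ^+ 2 * \sum_(k < 2 ^ n) ((k.*2.+1)%:R * c) ^- 2.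
  rewrite mulr_sumr; apply: eq_bigr => k _.
  by field; rewrite gt_eqF//= pnatr_eq0.
have sE := sinV2_sumE n.
have lo : \sum_(k < 2 ^ n) ((k.*2.+1)%:R * c) ^- 2 <= sinV2_sum n.
  apply: ler_sum => k _.
  by have /andP[] := sinV2_bounds (sinV2_angle (ltn_ord k)).
have hi : sinV2_sum n <= \sum_(k < 2 ^ n) ((k.*2.+1)%:R * c) ^- 2 + 2 ^+ n.
  have -> : 2 ^+ n = \sum_(k < 2 ^ n) 1 :> R.
    by rewrite sumr_const card_ord natrX.
  rewrite -big_split/=; apply: ler_sum => k _.
  by have /andP[] := sinV2_bounds (sinV2_angle (ltn_ord k)).
have p4 : (4 : R) ^+ n = (2 ^+ n) ^+ 2.
  by rewrite -exprM mulnC exprM; congr (_ ^+ n); rewrite -natrX.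
rewrite sE p4 in lo hi; rewrite oE.
have c20 : 0 <= c ^+ 2 by rewrite sqr_ge0.
apply/andP; split.
  apply: (@le_trans _ _ (c ^+ 2 * (2 * (2 ^+ n) ^+ 2 - 2 ^+ n))).
    by rewrite cE le_eqVlt; apply/orP; left; apply/eqP; field; rewrite gt_eqF.
  by rewrite ler_wpM2l// lerBlDr.
apply: (@le_trans _ _ (c ^+ 2 * (2 * (2 ^+ n) ^+ 2))); first by rewrite ler_wpM2l.
by rewrite cE le_eqVlt; apply/orP; left; apply/eqP; field; rewrite gt_eqF.
Qed.

Lemma cvg_odd_inv_sq : odd_inv_sq (2 ^ n) @[n --> \oo] --> pi ^+ 2 / 8.
Proof.
apply: (@squeeze_cvgr _ _ _ _
  (fun n : nat => pi ^+ 2 / 8 - pi ^+ 2 / 16 * 2 ^- n) (fun=> pi ^+ 2 / 8)).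
- by near=> n; exact: odd_inv_sq_bounds.
- rewrite -[X in _ --> X]subr0 -[X in _ - X](mulr0 (pi ^+ 2 / 16)).
  apply: cvgB; first exact: cvg_cst.
  apply: cvgMr; under eq_fun do rewrite -exprVn.
  by apply: cvg_expr; rewrite ger0_norm ?invr_ge0// invf_lt1// ltr1n.
- exact: cvg_cst.
Unshelve. all: by end_near. Qed.

Lemma inv_sq_double n :
  \sum_(k < n.*2) (k.+1%:R ^+ 2)^-1 =
  odd_inv_sq n + (\sum_(k < n) (k.+1%:R ^+ 2)^-1) / 4 :> R.
Proof.
elim: n => [|n IHn]; first by rewrite /odd_inv_sq !big_ord0 mul0r addr0.
rewrite doubleS /odd_inv_sq !big_ord_recr/= IHn /odd_inv_sq.
have -> : (n.*2.+2)%:R = 2 * n.+1%:R :> R by rewrite -natrM mul2n.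
set a := \sum_(_ < _) _; set b := \sum_(_ < _) _.
by rewrite -addnn; field; rewrite -!natrD -!(natrD _ 1) !pnatr_eq0.
Qed.

(** Splitting into odd and even terms along powers of two gives l = pi^2 / 8 + l / 4. Convergence is
    a hypothesis because the application supplies it, as the convergence of the variances of
    exponential maxima. *)
Lemma basel (l : R) :
  \sum_(k < n) (k.+1%:R ^+ 2)^-1 @[n --> \oo] --> l -> l = pi ^+ 2 / 6.
Proof.
move=> Zl.
have h2 : (2 ^ n)%N @[n --> \oo] --> \oo.
  apply/cvgnyPge => A; near=> n.
  rewrite (@leq_trans n)//; first by near: n; exact: nbhs_infty_ge.
  by rewrite ltnW// ltn_expl.
have Z2 : \sum_(k < 2 ^ n) (k.+1%:R ^+ 2)^-1 @[n --> \oo] --> l.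
  by apply: (cvg_comp _ _ h2 Zl).
have Z3 : \sum_(k < (2 ^ n).*2) (k.+1%:R ^+ 2)^-1 @[n --> \oo] --> l.
  have := Z2; rewrite -cvg_shiftS /=.
  by under eq_fun do rewrite /= expnS mul2n.
have Z4 : \sum_(k < (2 ^ n).*2) (k.+1%:R ^+ 2)^-1 @[n --> \oo]
    --> pi ^+ 2 / 8 + l / 4.
  under eq_fun do rewrite inv_sq_double.
  by apply: cvgD; [exact: cvg_odd_inv_sq|apply: cvgMl; exact: Z2].
have E : l = pi ^+ 2 / 8 + l / 4 by apply: cvg_unique Z3 Z4; exact: norm_hausdorff.
by move: E; lra.
Unshelve. all: by end_near. Qed.

End basel.

(** * Poisson tails and the distribution of the maximum *)

Section poisson_tail.
Context {R : realType}.
Implicit Types (m k : nat) (u v x : R).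

Definition exp_partial m u : R := \sum_(i < m) u ^+ i / i`!%:R.

(* The probability that a Poisson variable of mean u is smaller than m. *)
Definition poisson_lt m u : R := expR (- u) * exp_partial m u.

Lemma exp_partialS m u : exp_partial m.+1 u = exp_partial m u + u ^+ m / m`!%:R.
Proof. by rewrite /exp_partial big_ord_recr. Qed.

Lemma exp_partial0 m : exp_partial m.+1 0 = 1.
Proof.
elim: m => [|m IHm]; first by rewrite /exp_partial big_ord1 expr0 fact0 divr1.
by rewrite exp_partialS IHm expr0n mul0r addr0.
Qed.

Lemma exp_partial_ge0 m u : 0 <= u -> 0 <= exp_partial m u.
Proof. by move=> u0; rewrite sumr_ge0// => i _; rewrite mulr_ge0 ?exprn_ge0. Qed.

Lemma exp_partial_ge1 m u : 0 <= u -> 1 <= exp_partial m.+1 u.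
Proof.
move=> u0; rewrite /exp_partial big_ord_recl expr0 fact0 divr1 lerDl.
by rewrite sumr_ge0// => i _; rewrite mulr_ge0 ?exprn_ge0.
Qed.

Lemma poisson_ltS m u :
  poisson_lt m.+1 u = poisson_lt m u + expR (- u) * (u ^+ m / m`!%:R).
Proof. by rewrite /poisson_lt exp_partialS mulrDr. Qed.

Lemma poisson_lt0r m : poisson_lt m.+1 0 = 1.
Proof. by rewrite /poisson_lt exp_partial0 oppr0 expR0 mulr1. Qed.

Lemma poisson_lt_gt0 m u : 0 <= u -> 0 < poisson_lt m.+1 u.
Proof.
by move=> u0; rewrite mulr_gt0 ?expR_gt0// (lt_le_trans ltr01)// exp_partial_ge1.
Qed.

Lemma poisson_lt_ge0 m u : 0 <= u -> 0 <= poisson_lt m u.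
Proof. by move=> u0; rewrite mulr_ge0 ?expR_ge0// exp_partial_ge0. Qed.

Lemma is_derive_expRN x : is_derive x 1 (fun y => expR (- y)) (- expR (- x)).
Proof. by apply: is_derive_eq; rewrite /GRing.scale/=; ring. Qed.

(** The derivatives of the summands telescope to minus a Gamma density. Both the monotonicity of
    [poisson_lt] and the integrals of the Gamma densities come from this. *)
Lemma is_derive_poisson_lt m u :
  is_derive u 1 (poisson_lt m.+1) (- (expR (- u) * (u ^+ m / m`!%:R))).
Proof.
elim: m => [|m IHm].
  have -> : poisson_lt 1 = fun y => expR (- y).
    apply/funext => y; rewrite /poisson_lt /exp_partial big_ord1.
    by rewrite expr0 fact0 divr1 mulr1.
  rewrite expr0 fact0 divr1 mulr1; exact: is_derive_expRN.
have -> : poisson_lt m.+2 = poisson_lt m.+1 +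
    (fun y => expR (- y)) * id ^+ m.+1 * cst (m.+1`!%:R^-1).
  by apply/funext => y; rewrite poisson_ltS/= !fctE mulrA.
have dN := is_derive_expRN u.
apply: is_derive_eq; rewrite /GRing.scale/= factS natrM/=.
have f0 : m`!%:R != 0 :> R by rewrite pnatr_eq0 -lt0n fact_gt0.
by rewrite !fctE exprS; field; rewrite f0 -(natrD _ 1) pnatr_eq0.
Qed.

Lemma continuous_poisson_lt m : continuous (poisson_lt m.+1).
Proof.
move=> u; apply: differentiable_continuous; apply/derivable1_diffP.
have d := is_derive_poisson_lt m u; exact: ex_derive.
Qed.

Lemma le_poisson_lt m u v : 0 <= u -> u <= v ->
  poisson_lt m.+1 v <= poisson_lt m.+1 u.
Proof.
move=> u0 uv; rewrite -lerN2.
apply: (@derive_ge0_le _ (\- poisson_lt m.+1)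
  (fun y => - - (expR (- y) * (y ^+ m / m`!%:R)))) => // y /andP[uy _].
  by have d := is_derive_poisson_lt m y; exact: is_deriveN.
by rewrite opprK mulr_ge0 ?expR_ge0// divr_ge0// exprn_ge0// (le_trans u0).
Qed.

Lemma poisson_lt_le1 m u : 0 <= u -> poisson_lt m.+1 u <= 1.
Proof. by move=> u0; rewrite -(poisson_lt0r m) le_poisson_lt. Qed.

Lemma exp_partial_scale m u v : 0 < u -> u <= v ->
  exp_partial m.+1 v <= (v / u) ^+ m * exp_partial m.+1 u.
Proof.
move=> u0 uv; rewrite mulr_sumr; apply: ler_sum => i _.
have v0 : 0 < v by exact: lt_le_trans uv.
have -> : v ^+ i / i`!%:R = (v / u) ^+ i * (u ^+ i / i`!%:R) :> R.
  by rewrite exprMn exprVn mulrA divfK// expf_neq0// gt_eqF.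
rewrite ler_wpM2r ?divr_ge0 ?exprn_ge0 ?(ltW u0)//.
by rewrite ler_weXn2l ?ler_pdivlMr ?mul1r// -ltnS ltn_ord.
Qed.

Lemma le_exp_partial m u v : 0 <= u -> u <= v -> exp_partial m u <= exp_partial m v.
Proof.
move=> u0 uv; apply: ler_sum => i _.
by rewrite ler_wpM2r// lerXn2r// nnegrE (le_trans u0).
Qed.

(** A polynomial of degree m with nonnegative coefficients grows by at most (v / u)^m. With
    [poisson_lt_shift_ge] this pins the decay to exp(-(v - u)) up to a factor that tends to 1 when v
    - u stays bounded and u grows. *)
Lemma poisson_lt_shift_le m u v : 0 < u -> u <= v ->
  poisson_lt m.+1 v <= (v / u) ^+ m * expR (- (v - u)) * poisson_lt m.+1 u.
Proof.
move=> u0 uv; rewrite {1}/poisson_lt.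
have -> : expR (- v) = expR (- (v - u)) * expR (- u).
  by rewrite -expRD; congr expR; lra.
have -> : (v / u) ^+ m * expR (- (v - u)) * poisson_lt m.+1 u =
  expR (- (v - u)) * expR (- u) * ((v / u) ^+ m * exp_partial m.+1 u).
  by rewrite /poisson_lt; ring.
by rewrite ler_wpM2l ?mulr_ge0 ?expR_ge0// exp_partial_scale.
Qed.

Lemma poisson_lt_shift_ge m u v : 0 <= u -> u <= v ->
  expR (- (v - u)) * poisson_lt m.+1 u <= poisson_lt m.+1 v.
Proof.
move=> u0 uv; rewrite /poisson_lt mulrA -expRD.
have -> : - (v - u) + - u = - v by lra.
by rewrite ler_wpM2l ?expR_ge0// le_exp_partial.
Qed.

Lemma exprMexpRN_le k u : 0 <= u -> u ^+ k * expR (- u) <= k`!%:R.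
Proof.
move=> u0; rewrite expRN ler_pdivrMr ?expR_gt0//.
have k0 : 0 < k`!%:R :> R by rewrite ltr0n fact_gt0.
rewrite mulrC -ler_pdivrMr//; case: k k0 => [_|k k0].
  by rewrite expr0 fact0 divr1 (le_trans _ (expR_ge1Dx u))// lerDl.
by apply: le_trans (expR_ge1Dxn k u0); rewrite lerDr.
Qed.

Lemma poisson_lt_decay m k : exists2 C : R, 0 < C &
  forall u, 0 <= u -> u ^+ k * poisson_lt m.+1 u <= C.
Proof.
exists (\sum_(i < m.+1) (k + i)`!%:R).
  rewrite big_ord_recl ltr_pwDl// ?ltr0n ?fact_gt0// sumr_ge0//.
move=> u u0; rewrite /poisson_lt mulrA mulr_sumr; apply: ler_sum => i _.
have -> : u ^+ k * expR (- u) * (u ^+ i / i`!%:R) =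
  (u ^+ (k + i) * expR (- u)) / i`!%:R by rewrite exprD; ring.
rewrite ler_pdivrMr ?ltr0n ?fact_gt0//.
apply: le_trans (exprMexpRN_le _ u0) _.
by rewrite ler_peMr// ler1n fact_gt0.
Qed.

Lemma poisson_lt_cvg0 m : poisson_lt m.+1 u @[u --> +oo] --> 0.
Proof.
have [C C0 hC] := poisson_lt_decay m 1.
apply: (@squeeze_cvgr _ _ _ _ (fun=> 0) (fun u => C * u^-1)).
- near=> u.
  have u0 : 0 < u by near: u; exact: nbhs_pinfty_gt.
  rewrite (poisson_lt_ge0 _ (ltW u0))/= ler_pdivlMr// mulrC -[X in X * _]expr1.
  exact/hC/ltW.
- exact: cvg_cst.
- rewrite -(mulr0 C); apply: cvgMr.
  by apply/gtr0_cvgV0; [exact: nbhs_pinfty_gt|exact: cvg_id].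
Unshelve. all: by end_near. Qed.

End poisson_tail.

Section max_gamma.
Context {R : realType}.
Implicit Types (m : nat) (rs : seq R) (s t r x : R).

Lemma prod_onem_bounds (I : eqType) (l : seq I) (e : I -> R) :
  {in l, forall i, 0 <= e i <= 1} ->
  [/\ 0 <= \prod_(i <- l) (1 - e i) <= 1,
      1 - \sum_(i <- l) e i <= \prod_(i <- l) (1 - e i) &
      \prod_(i <- l) (1 - e i) <= expR (- \sum_(i <- l) e i)].
Proof.
elim: l => [_|i l IH h]; first by rewrite !big_nil subr0 oppr0 expR0 ler01 lexx.
have /andP[i0 i1] : 0 <= e i <= 1 by apply: h; rewrite mem_head.
have /IH[/andP[p0 p1] lo hi] : {in l, forall i, 0 <= e i <= 1}.
  by move=> j jl; apply: h; rewrite inE jl orbT.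
rewrite !big_cons; set p := \prod_(_ <- _) _ in p0 p1 lo hi *.
set S := \sum_(_ <- _) _ in lo hi *.
have i1' : 0 <= 1 - e i by rewrite subr_ge0.
split; first by rewrite mulr_ge0//= mulr_ile1// lerBlDr lerDl.
  nra.
rewrite opprD expRD ler_pM// (le_trans _ (expR_ge1Dx _))//.
Qed.

(** Since 1 / (1 - e) = 1 + e / (1 - e) <= exp(e / (1 - e)). As q tends to 0 this meets the upper
    bound exp(- sum) of [prod_onem_bounds], so the product converges as soon as the sum does. *)
Lemma prod_onem_ge (I : eqType) (l : seq I) (e : I -> R) (q : R) : q < 1 ->
  {in l, forall i, 0 <= e i <= q} ->
  expR (- (\sum_(i <- l) e i) / (1 - q)) <= \prod_(i <- l) (1 - e i).
Proof.
move=> q1; elim: l => [_|i l IH h]; first by rewrite !big_nil oppr0 mul0r expR0.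
have /andP[i0 iq] : 0 <= e i <= q by apply: h; rewrite mem_head.
have /IH lo : {in l, forall i, 0 <= e i <= q}.
  by move=> j jl; apply: h; rewrite inE jl orbT.
rewrite !big_cons opprD mulrDl expRD ler_pM ?expR_ge0//.
have i1 : 0 < 1 - e i by lra.
have q0 : 0 < 1 - q by lra.
rewrite -lef_pV2 ?posrE ?expR_gt0// -expRN mulNr opprK.
apply: (@le_trans _ _ (expR (e i / (1 - e i)))).
  by apply: le_trans (expR_ge1Dx _); rewrite le_eqVlt; apply/orP; left; apply/eqP; field; rewrite gt_eqF.
by rewrite ler_expR ler_wpM2l// lef_pV2 ?posrE//; lra.
Qed.

(** For the list of the r_j this is the h_N of the overview, and [max_cdf] is its F_N. *)
Definition lt_sum m rs s := \sum_(r <- rs) poisson_lt m (s * r).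

Definition max_cdf m rs s := \prod_(r <- rs) (1 - poisson_lt m (s * r)).

Variables (m : nat) (rs : seq R).
Hypothesis rs_ge1 : {in rs, forall r, 1 <= r}.

Let mul_ge0 s r : 0 <= s -> r \in rs -> 0 <= s * r.
Proof. by move=> s0 /rs_ge1 r1; rewrite mulr_ge0// (le_trans ler01). Qed.

Let lt01 s : 0 <= s -> {in rs, forall r, 0 <= poisson_lt m.+1 (s * r) <= 1}.
Proof.
by move=> s0 r rrs; rewrite poisson_lt_ge0 ?poisson_lt_le1 ?mul_ge0.
Qed.

Lemma max_cdf01 s : 0 <= s -> 0 <= max_cdf m.+1 rs s <= 1.
Proof. by move=> s0; have [] := prod_onem_bounds (lt01 s0). Qed.

Lemma onem_max_cdf_le s : 0 <= s -> 1 - max_cdf m.+1 rs s <= lt_sum m.+1 rs s.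
Proof.
by move=> s0; have [_ lo _] := prod_onem_bounds (lt01 s0); rewrite lerBlDr addrC -lerBlDr.
Qed.

Lemma max_cdf_le s : 0 <= s -> max_cdf m.+1 rs s <= expR (- lt_sum m.+1 rs s).
Proof. by move=> s0; have [] := prod_onem_bounds (lt01 s0). Qed.

Lemma max_cdf_ge s : 0 <= s -> poisson_lt m.+1 s < 1 ->
  expR (- lt_sum m.+1 rs s / (1 - poisson_lt m.+1 s)) <= max_cdf m.+1 rs s.
Proof.
move=> s0 q1; apply: prod_onem_ge => // r rrs.
rewrite poisson_lt_ge0 ?mul_ge0//= le_poisson_lt//.
by rewrite ler_peMr// rs_ge1.
Qed.

Lemma lt_sum_ge0 s : 0 <= s -> 0 <= lt_sum m rs s.
Proof.
move=> s0; rewrite /lt_sum big_seq sumr_ge0// => r rrs.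
by rewrite poisson_lt_ge0 ?mul_ge0.
Qed.

Lemma le_lt_sum s t : 0 <= s -> s <= t -> lt_sum m.+1 rs t <= lt_sum m.+1 rs s.
Proof.
move=> s0 st; rewrite /lt_sum big_seq [leRHS]big_seq; apply: ler_sum => r rrs.
by rewrite le_poisson_lt ?mul_ge0// ler_wpM2r// (le_trans ler01)// rs_ge1.
Qed.

Lemma lt_sum_shift_le s t : 0 < s -> s <= t ->
  lt_sum m.+1 rs t <= (t / s) ^+ m * expR (- (t - s)) * lt_sum m.+1 rs s.
Proof.
move=> s0 st; rewrite /lt_sum mulr_sumr big_seq [leRHS]big_seq.
apply: ler_sum => r rrs; have r1 := rs_ge1 rrs.
have r0 : 0 < r by rewrite (lt_le_trans ltr01).
apply: le_trans (poisson_lt_shift_le m (mulr_gt0 s0 r0) _) _.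
  by rewrite ler_wpM2r// ltW.
have -> : t * r / (s * r) = t / s by field; rewrite !gt_eqF.
rewrite ler_wpM2r ?poisson_lt_ge0 ?mul_ge0 ?(ltW s0)//.
rewrite ler_wpM2l ?exprn_ge0 ?divr_ge0 ?(le_trans (ltW s0) st) ?(ltW s0)//.
rewrite ler_expR lerN2 -mulrBl ler_peMr// subr_ge0//.
Qed.

Lemma lt_sum_le_size s : 0 <= s ->
  lt_sum m.+1 rs s <= (size rs)%:R * poisson_lt m.+1 s.
Proof.
move=> s0; rewrite /lt_sum big_seq.
have -> : (size rs)%:R * poisson_lt m.+1 s = \sum_(r <- rs) poisson_lt m.+1 s.
  by rewrite big_const_seq count_predT iter_addr_0 mulr_natl.
rewrite [leRHS]big_seq; apply: ler_sum => r rrs.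
by rewrite le_poisson_lt// ler_peMr// rs_ge1.
Qed.

Let cvg_mulr_lt s r :
  poisson_lt m.+1 (x * r) @[x --> s] --> poisson_lt m.+1 (s * r).
Proof.
have /= := @continuous_comp R R R (fun z => z * r) (poisson_lt m.+1) s.
by apply; [exact: mulrr_continuous|exact: continuous_poisson_lt].
Qed.

Lemma continuous_lt_sum : continuous (lt_sum m.+1 rs).
Proof.
move=> s; rewrite /lt_sum; elim: rs => [|r q IH].
  by under eq_fun do rewrite big_nil; exact: cvg_cst.
under eq_fun do rewrite big_cons.
by apply: cvgD; [exact: cvg_mulr_lt|exact: IH].
Qed.

Lemma continuous_max_cdf : continuous (max_cdf m.+1 rs).
Proof.
move=> s; rewrite /max_cdf; elim: rs => [|r q IH].
  by under eq_fun do rewrite big_nil; exact: cvg_cst.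
under eq_fun do rewrite big_cons.
apply: cvgM; last exact: IH.
by apply: cvgB; [exact: cvg_cst|exact: cvg_mulr_lt].
Qed.

End max_gamma.

(** * Convergence of the moments to those of the Gumbel law *)

Section gumbel_limit.
Context {R : realType}.
Local Notation mu := (@lebesgue_measure R).
Implicit Types (m n : nat) (s t r x : R).

Lemma Rdominated_convergence (f_ : nat -> R -> R) (f g : R -> R) :
  (forall n, measurable_fun setT (f_ n)) ->
  (forall x, f_ n x @[n --> \oo] --> f x) ->
  mu.-integrable setT (EFin \o g) ->
  (forall n x, `|f_ n x| <= g x) ->
  (forall n, mu.-integrable setT (EFin \o f_ n)) /\
  (\int[mu]_x f_ n x)%R @[n --> \oo] --> (\int[mu]_x f x)%R.
Proof.
move=> mf_ f_f ig f_g.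
have if_ n : mu.-integrable setT (EFin \o f_ n).
  apply: (le_integrable measurableT _ _ ig).
    by apply/measurable_EFinP; exact: mf_.
  move=> x _ /=; rewrite lee_fin; apply: (le_trans (f_g n x)); exact: ler_norm.
split=> //.
have mf : measurable_fun setT f.
  by apply: (measurable_fun_cvg (h := f_)) => // x _; exact: f_f.
have [] := @dominated_convergence _ _ R mu setT measurableT
    (fun n => EFin \o f_ n) (EFin \o f) (EFin \o g).
- by move=> n; apply/measurable_EFinP; exact: mf_.
- by apply/measurable_EFinP.
- by apply: aeW => /= x _; apply: cvg_EFin; [exact: nearW|exact: f_f].
- exact: ig.
- by apply: aeW => /= x n _; rewrite lee_fin; exact: f_g.
move=> ifE _ h; rewrite /Rintegral; apply: fine_cvg.
by rewrite fineK//; apply: integrable_fin_num.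
Qed.

Lemma integrable_expRN_norm (a : R) : 0 < a ->
  mu.-integrable setT (EFin \o (fun x : R => expR (- a * `|x|))).
Proof.
move=> a0.
have cf : continuous (fun x : R => expR (- a * `|x|)).
  move=> x; apply: continuous_comp; last exact: continuous_expR.
  by apply: cvgM; [exact: cvg_cst|exact: norm_continuous].
apply/integrableP; split.
  by apply/measurable_EFinP; exact: continuous_measurable_fun.
under eq_integral do rewrite /= ger0_norm ?expR_ge0//.
rewrite ge0_symfun_integralT//; last by move=> x /=; rewrite normrN.
rewrite -set_itvcy (_ : (\int[_]_(x in _) _)%E = (a^-1)%:E) ?ltry//.
transitivity ((0 - (- a^-1 * expR (- a * 0)))%:E); last first.
  by rewrite mulr0 expR0 mulr1 sub0r opprK.
rewrite EFinB.
transitivity (\int[mu]_(x in `[0%R, +oo[) (expR (- a * x))%:E)%E.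
  by apply: eq_integral => x; rewrite inE/= in_itv/= andbT => x0; rewrite ger0_norm.
have ca : continuous (fun x : R => expR (- a * x)).
  move=> x; apply: continuous_comp; last exact: continuous_expR.
  exact: mulrl_continuous.
have da x : is_derive x 1 (fun x : R => - a^-1 * expR (- a * x)) (expR (- a * x)).
  have -> : (fun x : R => - a^-1 * expR (- a * x)) =
     cst (- a^-1) * (expR \o (cst (- a) * id)) by [].
  by apply: is_derive_eq; rewrite !fctE /GRing.scale/=; field; rewrite gt_eqF.
apply: (@ge0_continuous_FTC2y _ _ (fun x => - a^-1 * expR (- a * x)) 0 0).
- by move=> x _; rewrite expR_ge0.
- exact: continuous_subspaceT.
- rewrite -(mulr0 (- a^-1)); apply: cvgMr.
  under eq_fun do rewrite mulNr.
  apply: (@cvg_comp _ _ _ (fun x => a * x) (fun x => expR (- x)) _ (pinfty_nbhs R)); last exact: cvgr_expR.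
  exact: gt0_cvgMry.
- by move=> x _; have := da x => dx; exact: ex_derive.
- apply: cvg_at_right_filter; apply: cvgMr; exact: ca.
- by move=> x _; have := da x => dx; rewrite derive1E derive_val.
Qed.

Lemma ge0_integral_translate (G : R -> R) (c : R) : continuous G ->
  (forall s, 0 <= s -> 0 <= G s) ->
  (\int[mu]_(s in `[0%R, +oo[) (G s)%:E =
   \int[mu]_(x in `[(- c)%R, +oo[) (G (c + x))%:E)%E.
Proof.
move=> cG G0.
have dF x : is_derive x 1 (fun x : R => c + x) 1.
  have -> : (fun x : R => c + x) = cst c + id by [].
  by apply: is_derive_eq; rewrite add0r.
have dFE x : derive1 (fun x : R => c + x) x = 1.
  by rewrite derive1E; have := dF x => dx; rewrite derive_val.
have cF : continuous (fun x : R => c + x).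
  by move=> x; apply: cvgD; [exact: cvg_cst|exact: cvg_id].
have dFT : derive1 (fun x : R => c + x) = cst 1 by apply/funext.
have := @increasing_ge0_integration_by_substitutiony R (fun x => c + x) G (- c).
rewrite subrr dFT => ->.
- by apply: eq_integral => x _; rewrite !fctE/= mulr1.
- by move=> x y _ _; rewrite ltrD2l.
- by move=> x _; exact: cvg_cst.
- exact: is_cvg_cst.
- exact: is_cvg_cst.
- split=> [x _|]; first by have := dF x => dx; exact: ex_derive.
  by apply: cvg_at_right_filter; exact: cF.
- apply: cvg_addrl.
- exact: continuous_subspaceT.
- by move=> x; rewrite in_itv/= andbT => x0; rewrite G0// ltW.
Qed.

End gumbel_limit.

Section gumbel.
Context {R : realType}.
Local Notation mu := (@lebesgue_measure R).

(* A distribution function on the half line, centred at c and compared with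
   the step function at 0, so that both tails become integrable. *)
Definition centered_tail (F : R -> R) (c x : R) : R :=
  if x < - c then 0 else 1 - F (c + x) - (x <= 0)%R%:R.

(** The untruncated analogue for the Gumbel law. Its integral is the mean, and twice the integral of
    x times it is the second moment. *)
Definition gumbel_tail (x : R) : R := 1 - expR (- expR (- x)) - (x <= 0)%R%:R.

(** This is y^m exp(-y) <= m! at y = (1 + x) / 2: half of the exponential pays for the polynomial,
    the other half remains. *)
Lemma expRN_half_bound (m : nat) (x : R) : 0 <= x ->
  (1 + x) ^+ m * expR (- x) <= expR 2^-1 * (2 ^+ m * m`!%:R) * expR (- 2^-1 * x).
Proof.
move=> x0; have := @exprMexpRN_le R m ((1 + x) / 2).
rewrite divr_ge0 ?addr_ge0// => /(_ isT) h.
have -> : (1 + x) ^+ m * expR (- x) =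
    2 ^+ m * (((1 + x) / 2) ^+ m * expR (- ((1 + x) / 2))) *
    (expR 2^-1 * expR (- 2^-1 * x)).
  rewrite expr_div_n.
  have -> : expR (- x) = expR (- ((1 + x) / 2)) * (expR 2^-1 * expR (- 2^-1 * x)).
    by rewrite -!expRD; congr expR; lra.
  by field.
have -> : expR 2^-1 * (2 ^+ m * m`!%:R) * expR (- 2^-1 * x) =
   2 ^+ m * m`!%:R * (expR 2^-1 * expR (- 2^-1 * x)) :> R by ring.
by rewrite ler_wpM2r ?mulr_ge0 ?expR_ge0// ler_wpM2l.
Qed.

Section tail_bound.
Variables (m : nat) (rs : seq R) (c : R).
Hypothesis rs_ge1 : {in rs, forall r, 1 <= r}.
Hypothesis c_ge1 : 1 <= c.
Hypothesis sum_c : lt_sum m.+1 rs c = 1.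

Let c_gt0 : 0 < c. Proof. exact: lt_le_trans c_ge1. Qed.

(** The first summand serves the right tail, the second the left tail. *)
Definition tail_const (m : nat) : R := expR 2^-1 * (2 ^+ m * m`!%:R) + 2 ^+ m.

(** Going left from c, [lt_sum_shift_le] loses the factor (c / (c - y))^m, which blows up near y =
    c. For y <= c / 2 it is at most 2^m; beyond, monotonicity reuses the value at c / 2, and y / 2
    <= c / 2 accounts for the halved exponent. *)
Lemma lt_sum_left (y : R) : 0 <= y <= c ->
  2 ^- m * expR (2^-1 * y) <= lt_sum m.+1 rs (c - y).
Proof.
have left z : 0 <= z <= c / 2 -> 2 ^- m * expR z <= lt_sum m.+1 rs (c - z).
  move=> /andP[z0 zc].
  have cz : 0 < c - z by rewrite subr_gt0; move: c_gt0; lra.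
  have := lt_sum_shift_le m rs_ge1 cz (_ : c - z <= c).
  rewrite sum_c gerBl => /(_ z0).
  have -> : c - (c - z) = z by lra.
  move=> h; rewrite -ler_pdivlMl ?invr_gt0 ?exprn_gt0// invrK.
  rewrite -[leLHS]mul1r -ler_pdivlMr ?expR_gt0// -expRN.
  apply: (le_trans h); rewrite [leRHS]mulrAC.
  rewrite ler_wpM2r// ?lt_sum_ge0 ?(ltW cz)// ler_wpM2r ?expR_ge0//.
  rewrite lerXn2r ?nnegrE ?divr_ge0 ?(ltW cz) ?(ltW c_gt0)//.
  by rewrite ler_pdivrMr//; lra.
move=> /andP[y0 yc]; have [yc2|yc2] := leP y (c / 2).
  apply: le_trans (left y _); last by rewrite y0.
  by rewrite ler_wpM2l ?invr_ge0 ?exprn_ge0// ler_expR; lra.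
apply: (@le_trans _ _ (lt_sum m.+1 rs (c - c / 2))).
  apply: le_trans (left (c / 2) _); last by rewrite lexx divr_ge0// ltW.
  by rewrite ler_wpM2l ?invr_ge0 ?exprn_ge0// ler_expR; lra.
by apply: le_lt_sum => //; lra.
Qed.

(** The bound depends neither on the ratios nor on c, hence dominates all N at once. On the right, 1
    - F <= h(c + x) <= (1 + x)^m exp(-x), where c >= 1 is used in (c + x) / c <= 1 + x. On the left,
    F <= exp(-h) <= 1 / h and [lt_sum_left] bounds h from below. *)
Lemma centered_tail_bound (x : R) :
  `|centered_tail (max_cdf m.+1 rs) c x| <= tail_const m * expR (- 2^-1 * `|x|).
Proof.
have e0 z : 0 <= expR z :> R by exact: expR_ge0.
have K1 : 0 <= expR 2^-1 * (2 ^+ m * m`!%:R) :> R by rewrite !mulr_ge0.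
rewrite /centered_tail; case: ltP => [_|xc].
  by rewrite normr0 mulr_ge0// addr_ge0.
have [x0|x0] := leP x 0; rewrite ?subr0/=; last first.
  have cx : 0 <= c + x by rewrite addr_ge0// ltW.
  have /andP[F0 F1] := max_cdf01 m rs_ge1 cx.
  rewrite ger0_norm ?subr_ge0//; apply: (le_trans (onem_max_cdf_le m rs_ge1 cx)).
  apply: (le_trans (lt_sum_shift_le m rs_ge1 c_gt0 (_ : c <= c + x))); first by rewrite lerDl ltW.
  rewrite sum_c mulr1 addrAC subrr add0r (gtr0_norm x0).
  apply: (@le_trans _ _ ((1 + x) ^+ m * expR (- x))).
    rewrite ler_wpM2r// lerXn2r ?nnegrE ?divr_ge0 ?addr_ge0 ?(ltW x0) ?(ltW c_gt0)//.
    by rewrite ler_pdivrMr// mulrDl mul1r lerD2l ler_peMr// ltW.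
  apply: (le_trans (expRN_half_bound m (ltW x0))).
  by rewrite ler_wpM2r// lerDl.
have cx : 0 <= c + x by move: xc; lra.
rewrite addrAC subrr add0r normrN (ler0_norm x0).
have /andP[F0 F1] := max_cdf01 m rs_ge1 cx.
rewrite ger0_norm//; apply: (le_trans (max_cdf_le m rs_ge1 cx)).
have := @lt_sum_left (- x); rewrite oppr_ge0 x0 opprK => /(_ _) h.
have {}h := h (_ : true && (- x <= c)).
have {}h : 2 ^- m * expR (2^-1 * - x) <= lt_sum m.+1 rs (c + x).
  by apply: h; rewrite /= lerNl.
have z0 : 0 < 2 ^- m * expR (2^-1 * - x) by rewrite mulr_gt0 ?expR_gt0// invr_gt0 exprn_gt0.
apply: (@le_trans _ _ (2 ^+ m * expR (- 2^-1 * - x))); last first.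
  by rewrite ler_wpM2r// lerDr.
have -> : 2 ^+ m * expR (- 2^-1 * - x) = (2 ^- m * expR (2^-1 * - x))^-1.
  by rewrite invfM invrK -expRN mulNr.
rewrite expRN lef_pV2 ?posrE ?expR_gt0//.
by apply: (le_trans h); apply: le_trans (expR_ge1Dx _); rewrite lerDr.
Qed.

End tail_bound.

Section convergence.
Variables (m : nat) (rs : nat -> seq R) (c : nat -> R).
Hypothesis rs_ge1 : forall n, {in rs n, forall r, 1 <= r}.
Hypothesis c_ge1 : forall n, 1 <= c n.
Hypothesis sum_c : forall n, lt_sum m.+1 (rs n) (c n) = 1.
Hypothesis c_pinfty : c n @[n --> \oo] --> +oo.
Hypothesis sum_cvg : forall x, lt_sum m.+1 (rs n) (c n + x) @[n --> \oo] --> expR (- x).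

Lemma max_cdf_cvg (x : R) :
  max_cdf m.+1 (rs n) (c n + x) @[n --> \oo] --> expR (- expR (- x)).
Proof.
have cx : c n + x @[n --> \oo] --> +oo.
  exact: (cvg_comp _ _ c_pinfty (cvg_addrr x)).
have q0 : poisson_lt m.+1 (c n + x) @[n --> \oo] --> (0 : R).
  exact: (cvg_comp _ _ cx (poisson_lt_cvg0 m)).
apply: (@squeeze_cvgr _ _ _ _
   (fun n => expR (- lt_sum m.+1 (rs n) (c n + x) / (1 - poisson_lt m.+1 (c n + x))))
   (fun n => expR (- lt_sum m.+1 (rs n) (c n + x)))).
- near=> n.
  have cx0 : 0 <= c n + x by near: n; move/cvgryPge: cx; apply.
  rewrite max_cdf_le// andbT max_cdf_ge//.
  by near: n; move/cvgrPdist_lt: q0 => /(_ 1 ltr01); apply: filterS => n;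
     rewrite sub0r normrN => /ltr_normlW.
- have h : - lt_sum m.+1 (rs n) (c n + x) / (1 - poisson_lt m.+1 (c n + x))
      @[n --> \oo] --> - expR (- x) / (1 - 0).
    apply: cvgM; first by apply: cvgN; exact: sum_cvg.
    by apply: cvgV; [rewrite subr0 oner_neq0|apply: cvgB; [exact: cvg_cst|exact: q0]].
  rewrite subr0 divr1 in h.
  by move: h; apply: continuous_cvg; exact: continuous_expR.
- have h : - lt_sum m.+1 (rs n) (c n + x) @[n --> \oo] --> - expR (- x).
    by apply: cvgN; exact: sum_cvg.
  by move: h; apply: continuous_cvg; exact: continuous_expR.
Unshelve. all: by end_near. Qed.

Lemma centered_tail_cvg (x : R) :
  centered_tail (max_cdf m.+1 (rs n)) (c n) x @[n --> \oo] --> gumbel_tail x.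
Proof.
have h := @max_cdf_cvg x.
have {}h : 1 - max_cdf m.+1 (rs n) (c n + x) - (x <= 0)%R%:R @[n --> \oo] --> gumbel_tail x.
  by apply: cvgB; [apply: cvgB; [exact: cvg_cst|exact: h]|exact: cvg_cst].
apply: cvg_trans h; apply: near_eq_cvg; near=> n.
rewrite /centered_tail ltNge ifF//; apply/negbTE; rewrite negbK lerNl.
by near: n; move/cvgryPge: c_pinfty; apply.
Unshelve. all: by end_near. Qed.

Let measurable_step : measurable_fun setT (fun x : R => (x <= 0)%R%:R : R).
Proof.
rewrite (_ : (fun _ => _) = fun x : R => if x <= 0 then 1 else 0 : R); last first.
  by apply/funext => x; case: (x <= 0).
by apply: measurable_fun_ifT => //; exact: measurable_fun_ler.
Qed.

Let continuous_shift_cdf n : continuous (fun x => max_cdf m.+1 (rs n) (c n + x)).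
Proof.
move=> x.
have h : c n + z @[z --> x] --> c n + x by apply: cvgD; [exact: cvg_cst|exact: cvg_id].
by move: h; apply: continuous_cvg; exact: continuous_max_cdf.
Qed.

Lemma measurable_centered_tail n :
  measurable_fun setT (centered_tail (max_cdf m.+1 (rs n)) (c n)).
Proof.
apply: measurable_fun_ifT => //; first exact: measurable_fun_ltr.
apply: measurable_funB => //; apply: measurable_funB => //.
exact: continuous_measurable_fun.
Qed.

Lemma integral_centered_tail_cvg :
  (forall n, mu.-integrable setT
     (EFin \o centered_tail (max_cdf m.+1 (rs n)) (c n))) /\
  (\int[mu]_x centered_tail (max_cdf m.+1 (rs n)) (c n) x)%R @[n --> \oo] -->
  (\int[mu]_x gumbel_tail x)%R.
Proof.
apply: (@Rdominated_convergence _ _ _ (fun x => tail_const m * expR (- 2^-1 * `|x|))).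
- exact: measurable_centered_tail.
- exact: centered_tail_cvg.
- rewrite (_ : _ \o _ = (fun x => (tail_const m)%:E * (expR (- 2^-1 * `|x|))%:E)%E)//.
  by apply: integrableZl => //; apply: integrable_expRN_norm; rewrite invr_gt0.
- by move=> n x; exact: centered_tail_bound.
Qed.

Lemma integral_id_centered_tail_cvg :
  (forall n, mu.-integrable setT
     (EFin \o fun x => x * centered_tail (max_cdf m.+1 (rs n)) (c n) x)) /\
  (\int[mu]_x (x * centered_tail (max_cdf m.+1 (rs n)) (c n) x))%R @[n --> \oo] -->
  (\int[mu]_x (x * gumbel_tail x))%R.
Proof.
apply: (@Rdominated_convergence _ _ _
  (fun x => (4 * tail_const m) * expR (- 4^-1 * `|x|))).
- by move=> n; apply: measurable_funM => //; exact: measurable_centered_tail.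
- by move=> x; apply: cvgM; [exact: cvg_cst|exact: centered_tail_cvg].
- rewrite (_ : _ \o _ = (fun x => (4 * tail_const m)%:E * (expR (- 4^-1 * `|x|))%:E)%E)//.
  by apply: integrableZl => //; apply: integrable_expRN_norm; rewrite invr_gt0.
- move=> n x; rewrite normrM.
  have K0 : 0 <= tail_const m by rewrite addr_ge0 ?mulr_ge0 ?expR_ge0.
  have hb := centered_tail_bound (@rs_ge1 n) (c_ge1 n) (sum_c n) x.
  apply: le_trans (ler_wpM2l (normr_ge0 x) hb) _.
  (* Half of the decay rate is spent on the factor |x|: y exp(-y) <= 1 at y = |x| / 4, which costs
     the constant 4. *)
  have -> : - 2^-1 * `|x| = - 4^-1 * `|x| + - (4^-1 * `|x|) by lra.
  have := @exprMexpRN_le R 1 (4^-1 * `|x|); rewrite mulr_ge0// => /(_ isT).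
  rewrite expr1 -[1`!]/1%N expRD => h.
  have -> : `|x| * (tail_const m * (expR (- 4^-1 * `|x|) * expR (- (4^-1 * `|x|)))) =
    4 * tail_const m * expR (- 4^-1 * `|x|) * (4^-1 * `|x| * expR (- (4^-1 * `|x|))) by field.
  by rewrite ler_piMr// !mulr_ge0 ?expR_ge0.
Qed.

End convergence.

Lemma ge0_integral_restrict (D : set R) (f : R -> R) (M : R) :
  measurable D -> continuous f -> (forall x, D x -> 0 <= f x) ->
  (\int[mu]_(x in D) (f x)%:E = M%:E)%E ->
  mu.-integrable setT (EFin \o (f \_ D)) /\ (\int[mu]_x (f \_ D) x)%R = M.
Proof.
move=> mD cf f0 fM.
have fM' : (\int[mu]_x ((f \_ D) x)%:E = M%:E)%E.
  by rewrite -fM [RHS]integral_mkcond restrict_EFin.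
split; last by rewrite /Rintegral fM'.
apply/integrableP; split.
  apply/measurable_EFinP; apply/(measurable_restrict _ mD measurableT) => //.
  by rewrite setTI; apply: measurable_funTS; exact: continuous_measurable_fun.
under eq_integral.
  move=> x _; rewrite /= ger0_norm; last by apply: restrict_ge0.
  over.
by rewrite /= fM' ltry.
Qed.

(** After the substitution s = c + x, the step function removes the integrals of 1 and of c + x over
    [-c, 0], that is c and c^2 / 2. The weight x is obtained as (c + x) - c. *)
Lemma centered_tail_moments (F : R -> R) (c M1 M2 : R) :
  0 < c -> continuous F -> (forall s, 0 <= s -> F s <= 1) ->
  mu.-integrable setT (EFin \o centered_tail F c) ->
  mu.-integrable setT (EFin \o (fun x => x * centered_tail F c x)) ->
  (\int[mu]_(s in `[0%R, +oo[) (1 - F s)%:E = M1%:E)%E ->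
  (\int[mu]_(s in `[0%R, +oo[) (s * (1 - F s))%:E = M2%:E)%E ->
  (\int[mu]_x centered_tail F c x)%R = M1 - c /\
  (\int[mu]_x (x * centered_tail F c x))%R = M2 - c ^+ 2 / 2 - c * (M1 - c).
Proof.
move=> c0 cF F1 iG ixG hM1 hM2.
have cS : continuous (fun x : R => c + x).
  by move=> x; apply: cvgD; [exact: cvg_cst|exact: cvg_id].
have cF1 : continuous (fun s => 1 - F s).
  by move=> s; apply: cvgB; [exact: cvg_cst|exact: cF].
have csF : continuous (fun s : R => s * (1 - F s) : R).
  by move=> s; apply: cvgM; [exact: cvg_id|exact: cF1].
have csh G : continuous G -> continuous (fun x : R => G (c + x) : R).
  by move=> cG x; have := cS x; apply: continuous_cvg; exact: cG.
have F10 s : 0 <= s -> 0 <= 1 - F s by move=> s0; rewrite subr_ge0 F1.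
have sF10 s : 0 <= s -> 0 <= s * (1 - F s) by move=> s0; rewrite mulr_ge0// F10.
rewrite (ge0_integral_translate c cF1 F10) in hM1.
rewrite (ge0_integral_translate c csF sF10) in hM2.
have h0 x : `[(- c), +oo[%classic x -> 0 <= c + x.
  by rewrite /= in_itv/= andbT; lra.
have [iA IA] := ge0_integral_restrict (measurable_itv _) (csh _ cF1)
  (fun x hx => F10 _ (h0 x hx)) hM1.
have [iA2 IA2] := ge0_integral_restrict (measurable_itv _) (csh _ csF)
  (fun x hx => sF10 _ (h0 x hx)) hM2.
have hB1 : (\int[mu]_(x in `[(- c)%R, 0%R]) (cst 1 x)%:E = c%:E)%E.
  transitivity (\int[mu]_(x in `[(- c)%R, 0%R]) (cst 1%E x))%E; first by [].
  by rewrite integral_cst//= mul1e lebesgue_measure_itv/= lte_fin oppr_lt0 c0 -EFinD opprK add0r.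
have hB2 : (\int[mu]_(x in `[(- c)%R, 0%R]) (c + x)%:E = (c ^+ 2 / 2)%:E)%E.
  have dF (x : R) : is_derive x 1 (fun x : R => (c + x) ^+ 2 / 2) (c + x).
    have -> : (fun x : R => (c + x) ^+ 2 / 2) = (cst c + id) ^+ 2 * cst (2^-1).
      by apply/funext => y; rewrite !fctE.
    by apply: is_derive_eq; rewrite !fctE /GRing.scale/=; field.
  have cF2 : continuous (fun x : R => (c + x) ^+ 2 / 2).
    by move=> x; apply: differentiable_continuous; apply/derivable1_diffP; have := dF x => dx; exact: ex_derive.
  rewrite (@continuous_FTC2 _ _ (fun x => (c + x) ^+ 2 / 2)).
  - by rewrite addr0 subrr expr0n mul0r sube0.
  - by rewrite oppr_lt0.
  - exact: continuous_subspaceT.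
  - split=> [x _||]; first by have := dF x => dx; exact: ex_derive.
      by apply: cvg_at_right_filter; exact: cF2.
    by apply: cvg_at_left_filter; exact: cF2.
  - by move=> x _; have := dF x => dx; rewrite derive1E derive_val.
have c1 : continuous (cst 1 : R -> R) by move=> x; exact: cvg_cst.
have [iB IB] := ge0_integral_restrict (measurable_itv _) c1 (fun x _ => ler01) hB1.
have h0' x : `[(- c), 0]%classic x -> 0 <= c + x by rewrite /= in_itv/=; lra.
have [iB2 IB2] := ge0_integral_restrict (measurable_itv _) cS h0' hB2.
have GE (x : R) : centered_tail F c x =
  ((fun x : R => 1 - F (c + x)) \_ `[(- c), +oo[) x - ((cst 1 : R -> R) \_ `[(- c), 0]) x.
  rewrite /centered_tail !patchE !mem_setE !in_itv/= andbT.
  by case: ltP => //= xc; rewrite ?subrr//; case: (x <= 0).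
have xGE (x : R) : x * centered_tail F c x + c * centered_tail F c x =
  ((fun x : R => (c + x) * (1 - F (c + x))) \_ `[(- c), +oo[) x -
  ((fun x : R => c + x) \_ `[(- c), 0]) x.
  rewrite GE !patchE !mem_setE !in_itv/= andbT.
  have pE : point = 0 :> R by [].
  by case: ltP => //= xc; rewrite ?pE; case: (x <= 0); ring.
have E1 : (\int[mu]_x centered_tail F c x)%R = M1 - c.
  under eq_Rintegral do rewrite GE.
  by rewrite RintegralB// IA IB.
split=> //; rewrite -E1 -RintegralZl//.
apply/eqP; rewrite -subr_eq opprK -RintegralD//; last first.
  exact: (integrableZl measurableT c iG).
apply/eqP; under eq_Rintegral do rewrite xGE.
by rewrite RintegralB// IA2 IB2.
Qed.

End gumbel.

Section moments_limit.
Context {R : realType}.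
Local Notation mu := (@lebesgue_measure R).
Variables (m : nat) (rs : nat -> seq R) (c M1 M2 : nat -> R).
Hypothesis rs_ge1 : forall n, {in rs n, forall r, 1 <= r}.
Hypothesis c_ge1 : forall n, 1 <= c n.
Hypothesis sum_c : forall n, lt_sum m.+1 (rs n) (c n) = 1.
Hypothesis c_pinfty : c n @[n --> \oo] --> +oo.
Hypothesis sum_cvg : forall x, lt_sum m.+1 (rs n) (c n + x) @[n --> \oo] --> expR (- x).
Hypothesis M1E : forall n,
  (\int[mu]_(s in `[0%R, +oo[) (1 - max_cdf m.+1 (rs n) s)%:E = (M1 n)%:E)%E.
Hypothesis M2E : forall n,
  (\int[mu]_(s in `[0%R, +oo[) (s * (1 - max_cdf m.+1 (rs n) s))%:E = (M2 n)%:E)%E.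

(** All terms in c cancel in twice the second centred integral minus the square of the first,
    leaving 2 M2 - M1^2; this is why it converges although both of its terms diverge. *)
Lemma moments_cvg :
  M1 n - c n @[n --> \oo] --> (\int[mu]_x gumbel_tail x)%R /\
  2 * M2 n - M1 n ^+ 2 @[n --> \oo] -->
    2 * (\int[mu]_x (x * gumbel_tail x))%R - (\int[mu]_x gumbel_tail x)%R ^+ 2.
Proof.
have [i1 l1] := integral_centered_tail_cvg rs_ge1 c_ge1 sum_c c_pinfty sum_cvg.
have [i2 l2] := integral_id_centered_tail_cvg rs_ge1 c_ge1 sum_c c_pinfty sum_cvg.
have mE n := centered_tail_moments (lt_le_trans ltr01 (c_ge1 n))
  (@continuous_max_cdf _ m (rs n))
  (fun s s0 => proj2 (andP (max_cdf01 m (@rs_ge1 n) s0))) (i1 n) (i2 n) (M1E n) (M2E n).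
split.
  by apply: cvg_trans l1; apply: near_eq_cvg; apply: nearW => n; have [-> _] := mE n.
have h : 2 * (\int[mu]_x (x * centered_tail (max_cdf m.+1 (rs n)) (c n) x))%R -
   (\int[mu]_x centered_tail (max_cdf m.+1 (rs n)) (c n) x)%R ^+ 2 @[n --> \oo] -->
   2 * (\int[mu]_x (x * gumbel_tail x))%R - (\int[mu]_x gumbel_tail x)%R ^+ 2.
  apply: cvgB; first by apply: cvgMr; exact: l2.
  by rewrite !expr2; under eq_fun do rewrite expr2; apply: cvgM; exact: l1.
apply: cvg_trans h; apply: near_eq_cvg; apply: nearW => n.
by have [-> ->] := mE n; field.
Qed.

End moments_limit.

(** * The maximum of independent exponential variables and the Gumbel variance *)

Section exponential_maximum.
Context {R : realType}.
Local Notation mu := (@lebesgue_measure R).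
Implicit Types (k n : nat) (s : R).

Let q s : R := 1 - expR (- s).

Let is_derive_q s : is_derive s 1 q (expR (- s)).
Proof.
have dN := is_derive_expRN s.
have -> : q = cst 1 - (fun s => expR (- s)) by [].
by apply: is_derive_eq; rewrite sub0r opprK.
Qed.

Definition harmonic_sum k : R := \sum_(i < k) i.+1%:R^-1.

(** An antiderivative of 1 - q^k: since q' = 1 - q, the derivative is (1 - q) times a geometric sum
    in q. *)
Let F1 k s : R := \sum_(i < k) q s ^+ i.+1 / i.+1%:R.

(** An antiderivative of s (1 - q^k), by parts: the summand of index i has derivative s q^i q', and
    these add up geometrically as for [F1]. *)
Let F2 k s : R := \sum_(i < k) (F1 i.+1 s - s * (1 - q s ^+ i.+1)) / i.+1%:R.

Let is_derive_F1 k s : is_derive s 1 (F1 k) (1 - q s ^+ k).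
Proof.
elim: k => [|k IHk].
  have -> : F1 0 = cst 0 by apply/funext => t; rewrite /F1 big_ord0.
  by rewrite expr0 subrr; exact: is_derive_cst.
have -> : F1 k.+1 = F1 k + q ^+ k.+1 * cst (k.+1%:R^-1).
  by apply/funext => t; rewrite /F1 big_ord_recr/= !fctE.
have dq := is_derive_q s.
apply: is_derive_eq; rewrite !fctE /GRing.scale/= exprS.
have -> : expR (- s) = 1 - q s by rewrite /q; ring.
by field; rewrite -(natrD _ 1) pnatr_eq0.
Qed.

Let is_derive_F2 k s : is_derive s 1 (F2 k) (s * (1 - q s ^+ k)).
Proof.
elim: k => [|k IHk].
  have -> : F2 0 = cst 0 by apply/funext => t; rewrite /F2 big_ord0.
  by rewrite expr0 subrr mulr0; exact: is_derive_cst.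
have -> : F2 k.+1 =
    F2 k + (F1 k.+1 - id * (cst 1 - q ^+ k.+1)) * cst (k.+1%:R^-1).
  by apply/funext => t; rewrite /F2 big_ord_recr/= !fctE.
have dq := is_derive_q s; have d1 := is_derive_F1 k.+1 s.
apply: is_derive_eq; rewrite !fctE /GRing.scale/= exprS.
have -> : expR (- s) = 1 - q s by rewrite /q; ring.
by field; rewrite -(natrD _ 1) pnatr_eq0.
Qed.

Let cvg_expRN : expR (- s) @[s --> +oo] --> (0 : R). Proof. exact: cvgr_expR. Qed.

Let cvg_q : q s @[s --> +oo] --> (1 : R).
Proof.
by rewrite -[X in _ --> X]subr0; apply: cvgB; [exact: cvg_cst|exact: cvg_expRN].
Qed.

Let cvg_qX k : q s ^+ k @[s --> +oo] --> (1 : R).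
Proof.
elim: k => [|k IHk]; first by under eq_fun do rewrite expr0; exact: cvg_cst.
have -> : (fun s => q s ^+ k.+1) = (fun s => q s * q s ^+ k).
  by apply/funext => s; rewrite exprS.
by rewrite -[X in _ --> X]mulr1; apply: cvgM; [exact: cvg_q|exact: IHk].
Qed.

Let cvg_idexp : s * expR (- s) @[s --> +oo] --> (0 : R).
Proof.
apply: (@squeeze_cvgr _ _ _ _ (fun=> 0) (fun s => 2 * s^-1)).
- near=> s.
  have s0 : 0 < s by near: s; exact: nbhs_pinfty_gt.
  rewrite mulr_ge0 ?expR_ge0 ?(ltW s0)//= ler_pdivlMr// mulrAC -expr2.
  exact: (exprMexpRN_le 2 (ltW s0)).
- exact: cvg_cst.
- rewrite -(mulr0 2); apply: cvgMr.
  by apply/gtr0_cvgV0; [exact: nbhs_pinfty_gt|exact: cvg_id].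
Unshelve. all: by end_near. Qed.

Let cvg_idqX k : s * (1 - q s ^+ k) @[s --> +oo] --> (0 : R).
Proof.
elim: k => [|k IHk].
  by under eq_fun do rewrite expr0 subrr mulr0; exact: cvg_cst.
have -> : (fun s => s * (1 - q s ^+ k.+1)) =
   (fun s => s * (1 - q s ^+ k) + s * expR (- s) * q s ^+ k).
  by apply/funext => s; rewrite exprS /q; ring.
rewrite -[X in _ --> X]addr0 -[X in _ --> _ + X](mul0r 1); apply: cvgD => //.
by apply: cvgM; [exact: cvg_idexp|exact: cvg_qX].
Qed.

Let cvg_F1 k : F1 k s @[s --> +oo] --> harmonic_sum k.
Proof.
rewrite /F1 /harmonic_sum; apply: cvg_big; first exact: add_continuous.
move=> i _.
by rewrite -[X in _ --> X]mul1r; apply: cvgMl; exact: cvg_qX.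
Qed.

Let cvg_F2 k : F2 k s @[s --> +oo] --> \sum_(i < k) harmonic_sum i.+1 / i.+1%:R.
Proof.
apply: cvg_big; first exact: add_continuous.
move=> i _; apply: cvgMl.
by rewrite -[X in _ --> X]subr0; apply: cvgB; [exact: cvg_F1|exact: cvg_idqX].
Qed.

Let q01 s : 0 <= s -> 0 <= q s <= 1.
Proof.
by move=> s0; rewrite /q subr_ge0 expR_le1 oppr_le0 s0 gerBl expR_ge0.
Qed.

Let continuous_derive (f : R -> R) (df : R -> R) :
  (forall s, is_derive s 1 f (df s)) -> continuous f.
Proof.
move=> d s; apply: differentiable_continuous; apply/derivable1_diffP.
have ds := d s; exact: ex_derive.
Qed.

Let FTC (F f : R -> R) (l : R) : (forall s, is_derive s 1 F (f s)) -> continuous f ->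
  (forall s, 0 <= s -> 0 <= f s) -> F s @[s --> +oo] --> l -> F 0 = 0 ->
  (\int[mu]_(s in `[0%R, +oo[) (f s)%:E = l%:E)%E.
Proof.
move=> dF cf f0 Fl F0.
rewrite (@ge0_continuous_FTC2y _ f F 0 l)//.
- by rewrite F0 sube0.
- exact: continuous_subspaceT.
- by apply: cvg_at_right_filter; exact: (continuous_derive dF).
- by move=> s _; have ds := dF s; rewrite derive1E derive_val.
Qed.

Let q0 : q 0 = 0. Proof. by rewrite /q oppr0 expR0 subrr. Qed.

Let F10 k : F1 k 0 = 0.
Proof. by rewrite /F1 big1// => i _; rewrite q0 expr0n mul0r. Qed.

Let continuous_qX k : continuous (fun s => 1 - q s ^+ k).
Proof.
move=> s; apply: cvgB; first exact: cvg_cst.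
have cq : q t @[t --> s] --> q s by exact: (continuous_derive is_derive_q).
elim: k => [|k IHk]; first by under eq_fun do rewrite expr0; exact: cvg_cst.
by under eq_fun do rewrite exprS; rewrite exprS; apply: cvgM.
Qed.

Let onem_qX_ge0 k s : 0 <= s -> 0 <= 1 - q s ^+ k.
Proof.
by move=> s0; have /andP[h0 h1] := q01 s0; rewrite subr_ge0 exprn_ile1.
Qed.

Let max_cdf_nseq k s : max_cdf 1 (nseq k 1) s = q s ^+ k.
Proof.
rewrite /max_cdf (eq_big_seq (fun=> q s)); last first.
  move=> r /nseqP[-> _]; rewrite mulr1 /q /poisson_lt /exp_partial.
  by rewrite big_ord1 expr0 fact0 divr1 mulr1.
by rewrite big_const_seq count_predT size_nseq iter_mulr_1.
Qed.

Let lt_sum_nseq k s : lt_sum 1 (nseq k 1) s = k%:R * expR (- s).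
Proof.
rewrite /lt_sum (eq_big_seq (fun=> expR (- s))); last first.
  move=> r /nseqP[-> _]; rewrite mulr1 /poisson_lt /exp_partial.
  by rewrite big_ord1 expr0 fact0 divr1 mulr1.
by rewrite big_const_seq count_predT size_nseq iter_addr_0 mulr_natl.
Qed.

(** The left side is 2 M2 - M1^2 for k exponential variables. Passing from k to k + 1, the cross
    terms 2 H_k / (k + 1) cancel. *)
Lemma harmonic_sum_sq k :
  2 * (\sum_(i < k) harmonic_sum i.+1 / i.+1%:R) - harmonic_sum k ^+ 2 =
  \sum_(i < k) (i.+1%:R ^+ 2)^-1.
Proof.
elim: k => [|k IHk].
  by rewrite /harmonic_sum !big_ord0 mulr0 expr0n subrr.
rewrite !big_ord_recr/= -IHk.
have -> : harmonic_sum k.+1 = harmonic_sum k + k.+1%:R^-1.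
  by rewrite /harmonic_sum big_ord_recr.
by field; rewrite -(natrD _ 1) pnatr_eq0.
Qed.

Let expR1_le4 : expR 1 <= 4 :> R.
Proof.
have h : expR (- 2^-1) >= 2^-1 :> R by apply: le_trans (expR_ge1Dx _); lra.
have h2 : expR 2^-1 <= 2 :> R.
  by rewrite -[expR _]invrK -expRN -[leRHS]invrK lef_pV2 ?posrE ?expR_gt0// invr_gt0.
have -> : 1 = 2^-1 + 2^-1 :> R by field.
have e0 := expR_ge0 (2^-1 : R).
by rewrite expRD; nra.
Qed.

(* The Gumbel law is the limit of the centred maximum of n independent
   exponential variables, whose variance is the sum of 1/k^2 for k <= n. *)
Lemma gumbel_variance :
  2 * (\int[mu]_x (x * gumbel_tail x))%R - (\int[mu]_x gumbel_tail x)%R ^+ 2 =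
  pi ^+ 2 / 6.
Proof.
(* Starting at four makes the centre ln k at least 1, as e <= 4. With all ratios equal to 1 and a
   single copy required, h(s) = k exp(-s), so ln k is the exact centre and h(ln k + x) equals
   exp(-x) for every k. *)
pose k n := n.+4.
have k0 n : 0 < (k n)%:R :> R by rewrite ltr0n.
have [|||||||_ h] := @moments_cvg R 0 (fun n => nseq (k n) 1) (fun n => ln (k n)%:R)
  (fun n => harmonic_sum (k n))
  (fun n => \sum_(i < k n) harmonic_sum i.+1 / i.+1%:R).
- by move=> n r /nseqP[-> _].
- move=> n; rewrite -ler_expR lnK ?posrE//.
  by apply: (le_trans expR1_le4); rewrite ler_nat.
- by move=> n; rewrite lt_sum_nseq expRN lnK ?posrE// divff// gt_eqF.
- apply/cvgryPge => A; near=> n; rewrite -ler_expR lnK ?posrE//.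
  apply: (@le_trans _ _ n%:R); last by rewrite ler_nat /k; lia.
  by near: n; exact: nbhs_infty_ger.
- move=> x; rewrite [X in X @ _ --> _](_ : _ = cst (expR (- x))); first exact: cvg_cst.
  apply/funext => n; rewrite lt_sum_nseq opprD expRD (expRN (ln _)) lnK ?posrE//.
  by rewrite mulrA divff ?mul1r// gt_eqF.
- move=> n; under eq_integral do rewrite max_cdf_nseq.
  exact: (FTC (is_derive_F1 _) (@continuous_qX _) (@onem_qX_ge0 _) (@cvg_F1 _)).
- move=> n; under eq_integral do rewrite max_cdf_nseq.
  apply: (FTC (is_derive_F2 _) _ _ (@cvg_F2 _)).
  + by move=> s; apply: cvgM; [exact: cvg_id|exact: continuous_qX].
  + by move=> s s0; rewrite mulr_ge0// onem_qX_ge0.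
  + by rewrite /F2 big1// => i _; rewrite F10 mul0r subrr mul0r.
apply: basel.
rewrite -(cvg_shiftn 4); apply: cvg_trans h; apply: near_eq_cvg.
by apply: nearW => n; rewrite harmonic_sum_sq /= addn4.
Unshelve. all: by end_near. Qed.

End exponential_maximum.

Lemma is_derive_mull (R : realType) (c x : R) : is_derive x 1 (fun y => c * y) c.
Proof.
have := is_deriveM (is_derive_cst c x 1) (is_derive_id x 1).
by rewrite !fctE /GRing.scale/= mulr0 addr0 mulr1.
Qed.

Lemma is_derive_affineMX (R : realType) (f : R -> R) (a b x df : R) (C : nat) :
  is_derive x 1 f df ->
  is_derive x 1 (fun t => (a + b * t) * f t ^+ C)
    ((a + b * x) * (C%:R * f x ^+ C.-1 * df) + f x ^+ C * b).
Proof.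
move=> dfx.
have -> : (fun t => (a + b * t) * f t ^+ C) = (cst a + cst b * id) * f ^+ C.
  by apply/funext => t; rewrite !fctE.
have := is_deriveM (is_deriveD (is_derive_cst a x 1) (is_derive_mull b x))
  (is_deriveX C dfx).
by rewrite !fctE /GRing.scale/= add0r mulrA.
Qed.

(** * Concentration of the expected number of missing coupons *)

Section ratio_estimates.
Context {R : realType}.
Implicit Types x y z s r d : R.
Variables (f f' : R -> R) (n0 C : nat).
Hypothesis f_gt0 : forall x, 0 < x -> 0 < f x.
Hypothesis f'_gt0 : forall x, 0 < x -> 0 < f' x.
Hypothesis f_derive : forall x, 0 < x -> is_derive x 1 f (f' x).
Hypothesis n0_gt0 : (0 < n0)%N.
Hypothesis C_gt0 : (0 < C)%N.

Let g x := f x / f' x.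

Hypothesis g_lip : forall y z, n0%:R <= y -> y <= z -> `|g z - g y| <= C%:R * (z - y).
Hypothesis g_pinfty : g N%:R @[N --> \oo] --> +oo.

Let n0_gt0R : 0 < n0%:R :> R. Proof. by rewrite ltr0n. Qed.

Let g_gt0 x : 0 < x -> 0 < g x.
Proof. by move=> x0; rewrite divr_gt0 ?f_gt0 ?f'_gt0. Qed.

(* (g z + C (z - x)) f(x)^C is nondecreasing in x <= z because g is C-Lipschitz
   and f = f' g; ratio_upper is the same argument with C replaced by - C. *)
Lemma ratio_lower y z : n0%:R <= y -> y <= z ->
  (g z + C%:R * (z - y)) * f y ^+ C <= g z * f z ^+ C.
Proof.
move=> n0y yz.
pose a := g z + C%:R * z.
have aE x : a + - C%:R * x = g z + C%:R * (z - x) by rewrite /a; ring.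
suff : (a + - C%:R * y) * f y ^+ C <= (a + - C%:R * z) * f z ^+ C.
  by rewrite !aE subrr mulr0 addr0.
apply: (@derive_ge0_le _ (fun x => (a + - C%:R * x) * f x ^+ C)
  (fun x => (a + - C%:R * x) * (C%:R * f x ^+ C.-1 * f' x) + f x ^+ C * - C%:R) _ _ yz).
  move=> x /andP[yx xz]; apply: is_derive_affineMX; apply: f_derive.
  by rewrite (lt_le_trans n0_gt0R)// (le_trans n0y).
move=> x /andP[yx xz]; have x0 : 0 < x by rewrite (lt_le_trans n0_gt0R)// (le_trans n0y).
rewrite aE -[in f x ^+ C](prednK C_gt0) exprS.
have -> : f x = f' x * g x by rewrite /g mulrCA divff ?mulr1// gt_eqF ?f'_gt0.
set u := _ ^+ C.-1; set v := f' x.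
have -> : (g z + C%:R * (z - x)) * (C%:R * u * v) + v * g x * u * - C%:R =
  (C%:R * u * v) * (g z + C%:R * (z - x) - g x) by ring.
have v0 : 0 <= v by rewrite /v ltW// f'_gt0.
have u0 : 0 <= u by rewrite /u exprn_ge0// mulr_ge0// ltW// g_gt0.
apply: mulr_ge0; first by rewrite !mulr_ge0.
have := g_lip (le_trans n0y yx) xz.
by rewrite distrC => /(le_trans (ler_norm _)); lra.
Qed.

Lemma ratio_upper y z : n0%:R <= y -> y <= z ->
  (g z - C%:R * (z - y)) * f z ^+ C <= g z * f y ^+ C.
Proof.
move=> n0y yz.
have y0 : 0 < y by rewrite (lt_le_trans n0_gt0R).
have z0 : 0 < z by rewrite (lt_le_trans y0).
have fy := exprn_gt0 C (f_gt0 y0); have fz := exprn_gt0 C (f_gt0 z0).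
pose a := g z - C%:R * z.
have aE x : a + C%:R * x = g z - C%:R * (z - x) by rewrite /a; ring.
suff : (a + C%:R * y) * (f y)^-1 ^+ C <= (a + C%:R * z) * (f z)^-1 ^+ C.
  by rewrite !aE subrr mulr0 subr0 !exprVn ler_pdivrMr// mulrAC ler_pdivlMr.
apply: (@derive_ge0_le _ (fun x => (a + C%:R * x) * (f x)^-1 ^+ C)
  (fun x => (a + C%:R * x) * (C%:R * (f x)^-1 ^+ C.-1 * (- (f x) ^- 2 * f' x)) +
    (f x)^-1 ^+ C * C%:R) _ _ yz).
  move=> x /andP[yx xz]; have x0 : 0 < x by rewrite (lt_le_trans y0).
  have fx := f_gt0 x0; have df := f_derive x0.
  apply: (@is_derive_affineMX _ (fun t => (f t)^-1) a C%:R x (- (f x) ^- 2 * f' x)).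
  have dfx : derivable f x 1 by exact: ex_derive.
  apply: DeriveDef; first by apply: derivableV; rewrite ?gt_eqF.
  by rewrite deriveV ?gt_eqF// derive_val.
move=> x /andP[yx xz]; have x0 : 0 < x by rewrite (lt_le_trans y0).
rewrite aE -[in (f x)^-1 ^+ C](prednK C_gt0) [_ ^+ C.-1.+1]exprS.
have fE : f x = f' x * g x by rewrite /g mulrCA divff ?mulr1// gt_eqF ?f'_gt0.
have fx := f_gt0 x0; have fx' := f'_gt0 x0.
have fV : (f x)^-1 = f x ^- 2 * (f' x * g x) by rewrite -fE; field; rewrite gt_eqF.
set u := _ ^+ C.-1; rewrite fV; set v := f' x; set w := f x ^- 2.
have -> : (g z - C%:R * (z - x)) * (C%:R * u * (- w * v)) + w * (v * g x) * u * C%:R =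
  (C%:R * u * (w * v)) * (g x - (g z - C%:R * (z - x))) by ring.
have v0 : 0 <= v by rewrite /v ltW.
have w0 : 0 <= w by rewrite /w invr_ge0 exprn_ge0// ltW.
have u0 : 0 <= u by rewrite /u exprn_ge0// invr_ge0 ltW.
apply: mulr_ge0; first by rewrite !mulr_ge0.
have := g_lip (le_trans n0y yx) xz.
by move/(le_trans (ler_norm _)); lra.
Qed.

Lemma le_f x y : 0 < x -> x <= y -> f x <= f y.
Proof.
move=> x0 xy; apply: (derive_ge0_le (df := f')) => // t /andP[xt _].
  by apply: f_derive; exact: lt_le_trans xt.
by rewrite ltW// f'_gt0// (lt_le_trans x0).
Qed.

(* The ratios p_j / p_N, listed from j = N down to j = 1. *)
Definition ratios N : seq R := [seq f N%:R / f (N - k)%:R | k <- iota 0 N].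

Lemma size_ratios N : size (ratios N) = N.
Proof. by rewrite size_map size_iota. Qed.

Lemma ratios_ge1 N : {in ratios N, forall r, 1 <= r}.
Proof.
move=> r /mapP[k]; rewrite mem_iota add0n => /andP[_ kN] ->.
have Nk0 : 0 < (N - k)%:R :> R by rewrite ltr0n subn_gt0.
by rewrite ler_pdivlMr ?f_gt0// mul1r le_f// ler_nat leq_subr.
Qed.

Section fixed_m.
Variable m : nat.

Let h N s := lt_sum m.+1 (ratios N) s.

Let term N s k := poisson_lt m.+1 (s * (f N%:R / f (N - k)%:R)).

Let hE N s : h N s = \sum_(k < N) term N s k.
Proof.
rewrite /h /lt_sum big_map -[X in iota 0 X](subn0 N) -/(index_iota 0 N).
by rewrite big_mkord.
Qed.

Let term_ge0 N s k : 0 <= s -> (k < N)%N -> 0 <= term N s k.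
Proof.
move=> s0 kN; apply: poisson_lt_ge0; rewrite mulr_ge0//.
by rewrite divr_ge0 ?ltW ?f_gt0// ltr0n ?subn_gt0// (leq_trans _ kN).
Qed.

(** At least eta g(N) ratios lie in [1, 1 + d / 2]: if C k <= (d / 4) g(N), [ratio_upper] gives r <=
    r^C <= 1 / (1 - d / 4) <= 1 + d / 2. The far ratios are later measured against this lower
    bound. *)
Lemma lt_sum_ratios_ge d : 0 < d <= 1 -> exists2 eta, 0 < eta &
  \forall N \near \oo, forall s, 0 <= s ->
    eta * g N%:R * poisson_lt m.+1 (s * (1 + d / 2)) <= h N s.
Proof.
move=> /andP[d0 d1].
have C0 : 0 < C%:R :> R by rewrite ltr0n.
have [eta eta0 etaC] : exists2 eta, 0 < eta & C%:R * eta = d / 4.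
  by exists (d / 4 / C%:R); rewrite ?divr_gt0// mulrC divfK// gt_eqF.
exists eta => //; near=> N => s s0.
have nN : (n0 <= N)%N by near: N; exact: nbhs_infty_ge.
have N0 : (0 < N)%N by exact: leq_trans nN.
have G0 : 0 < g N%:R by rewrite g_gt0// ltr0n.
pose K := Num.truncn (eta * g N%:R).
have KE : K%:R <= eta * g N%:R < K.+1%:R by apply: truncn_itv; rewrite mulr_ge0// ltW.
(* The indices used must stay above n0, where g is controlled. The Lipschitz bound gives eta g(N) <=
   eta g(n0) + (d / 4) (N - n0), which leaves room for large N. *)
have KN : (K + n0 <= N)%N.
  rewrite -(ler_nat R) natrD -lerBrDr; apply: (le_trans (proj1 (andP KE))).
  have := g_lip (lexx _) (_ : n0%:R <= N%:R); rewrite ler_nat => /(_ nN).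
  move=> /(le_trans (ler_norm _)) hg.
  have hN : 2 * (eta * g n0%:R) + n0%:R <= N%:R by near: N; exact: nbhs_infty_ger.
  have : eta * (g N%:R - g n0%:R) <= d / 4 * (N%:R - n0%:R).
    by rewrite -etaC mulrAC [leRHS]mulrC; apply: ler_wpM2l; rewrite ?(ltW eta0).
  have : n0%:R <= N%:R :> R by rewrite ler_nat.
  have : 0 < eta * g n0%:R by rewrite mulr_gt0// g_gt0.
  rewrite mulrBr => *; nra.
have KN1 : (K.+1 <= N)%N by apply: leq_trans KN; rewrite -addn1 leq_add2l.
rewrite hE; apply: (@le_trans _ _ (\sum_(k < K.+1) term N s k)); last first.
  rewrite (big_ord_widen _ (term N s) KN1) big_mkcond/=; apply: ler_sum => k _.
  by case: ifP => // _; rewrite term_ge0.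
apply: (@le_trans _ _ (\sum_(k < K.+1) poisson_lt m.+1 (s * (1 + d / 2)))).
  rewrite sumr_const card_ord -[leRHS]mulr_natl ler_wpM2r//.
    by rewrite poisson_lt_ge0// mulr_ge0// addr_ge0// divr_ge0// ltW.
  by have /andP[_ /ltW] := KE.
apply: ler_sum => k _; have kK : (k <= K)%N by rewrite -ltnS.
have kN : (k < N)%N by exact: leq_ltn_trans kK KN1.
have Nk0 : 0 < (N - k)%:R :> R by rewrite ltr0n subn_gt0.
have fN0 : 0 < f N%:R by rewrite f_gt0 ?ltr0n.
have fk0 := f_gt0 Nk0.
apply: le_poisson_lt; first by rewrite mulr_ge0// divr_ge0// ltW.
rewrite ler_wpM2l//.
have n0k : n0%:R <= (N - k)%:R :> R.
  by rewrite ler_nat leq_subRL ?(ltnW kN)// (leq_trans _ KN)// leq_add2r.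
have := ratio_upper n0k (_ : (N - k)%:R <= N%:R); rewrite ler_nat leq_subr => /(_ isT).
have -> : N%:R - (N - k)%:R = k%:R :> R by rewrite natrB ?(ltnW kN)// opprB addrC subrK.
move=> hr; set r := f N%:R / _.
have rN : f N%:R = r * f (N - k)%:R by rewrite /r divfK// gt_eqF.
have r1 : 1 <= r by rewrite /r ler_pdivlMr// mul1r le_f// ler_nat leq_subr.
have r0 : 0 < r by exact: lt_le_trans r1.
have kg : C%:R * k%:R <= d / 4 * g N%:R.
  rewrite -etaC -mulrA ler_wpM2l ?(ltW C0)//.
  by have /andP[hK _] := KE; apply: le_trans hK; rewrite ler_nat.
have rC : (1 - d / 4) * r ^+ C <= 1.
  rewrite rN exprMn mulrA ler_pM2r ?exprn_gt0// in hr.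
  rewrite -(ler_pM2l G0) mulr1 mulrA; apply: le_trans hr.
  by rewrite ler_wpM2r ?exprn_ge0 ?(ltW r0)// mulrBr mulr1; lra.
have rrC : r <= r ^+ C by rewrite -[leLHS]expr1 ler_weXn2l.
nra.
Unshelve. all: by end_near. Qed.

(** For r > 1 + d the gap r - (1 + d / 2) is at least kappa r, with near equality at r = 1 + d.
    Hence Q(s r) gains exp(-s kappa r) over Q(s (1 + d / 2)), which absorbs r^(m + 2 C) and leaves
    s^-n <= 1 / s. The power 2 C is the one that turns the growth of r^C into the summable (1 + k /
    g(N))^-2. *)
Lemma poisson_lt_tail d : 0 < d -> exists2 D, 0 < D &
  forall s r, 1 <= s -> 1 + d < r ->
    poisson_lt m.+1 (s * r) * r ^+ (2 * C) <=
    D / s * poisson_lt m.+1 (s * (1 + d / 2)).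
Proof.
move=> d0.
have d1 : 0 < 1 + d by rewrite addr_gt0.
pose kappa := d / 2 / (1 + d).
have kappa0 : 0 < kappa by rewrite !divr_gt0.
have kd : kappa * (1 + d) = d / 2 by rewrite /kappa divfK// gt_eqF.
pose n := (m + 2 * C)%N.
have n1 : (1 <= n)%N by rewrite /n; move: C_gt0; lia.
exists (n`!%:R / kappa ^+ n); first by rewrite divr_gt0 ?exprn_gt0 ?ltr0n ?fact_gt0.
move=> s r s1 dr; clearbody kappa.
have s0 : 0 < s by exact: lt_le_trans s1.
have r0 : 0 < r by exact: lt_trans dr.
have d2 : 0 < 1 + d / 2 by lra.
set q := poisson_lt m.+1 (s * (1 + d / 2)).
have q0 : 0 <= q by rewrite poisson_lt_ge0// ltW// mulr_gt0.
have le1 : poisson_lt m.+1 (s * r) <= r ^+ m * expR (- (s * (kappa * r))) * q.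
  apply: le_trans (poisson_lt_shift_le m (mulr_gt0 s0 d2) _) _.
    by rewrite ler_pM2l//; lra.
  apply: ler_wpM2r => //; apply: ler_pM; rewrite ?expR_ge0 ?exprn_ge0//.
  - by rewrite divr_ge0// ltW// mulr_gt0.
  - have -> : s * r / (s * (1 + d / 2)) = r / (1 + d / 2)
      by rewrite invfM mulrACA divff ?mul1r// gt_eqF.
    rewrite lerXn2r ?nnegrE ?divr_ge0 ?(ltW r0) ?(ltW d2)//.
    by rewrite ler_pdivrMr// ler_peMr ?(ltW r0)// lerDl divr_ge0// ltW.
  - by rewrite ler_expR lerN2 -mulrBr ler_pM2l//; nra.
have := exprMexpRN_le n (ltW (mulr_gt0 s0 (mulr_gt0 kappa0 r0))).
rewrite !exprMn => le2.
apply: le_trans (ler_wpM2r (exprn_ge0 (2 * C) (ltW r0)) le1) _.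
rewrite [leLHS]mulrAC; apply: ler_wpM2r => //.
rewrite [leLHS]mulrAC -exprD -/n.
rewrite -[leRHS]mulrA -invfM ler_pdivlMr ?mulr_gt0 ?exprn_gt0//.
apply: le_trans le2.
have sn : s <= s ^+ n by rewrite -[leLHS]expr1 ler_weXn2l.
have -> : r ^+ n * expR (- (s * (kappa * r))) * (kappa ^+ n * s) =
  s * (kappa ^+ n * r ^+ n * expR (- (s * (kappa * r)))) by ring.
have -> : s ^+ n * (kappa ^+ n * r ^+ n) * expR (- (s * (kappa * r))) =
  s ^+ n * (kappa ^+ n * r ^+ n * expR (- (s * (kappa * r)))) by ring.
by apply: ler_wpM2r => //; rewrite !mulr_ge0 ?expR_ge0 ?exprn_ge0 ?(ltW kappa0) ?(ltW r0).
Qed.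

(** With k0 = n0 this counts the types below n0, on which the Lipschitz bound gives no
    information. *)
Lemma sum_near_end_le N k0 : (\sum_(k < N) (N - k < k0) <= k0)%N.
Proof.
rewrite (reindex_inj rev_ord_inj)/=.
apply: (@leq_trans (\sum_(k < N) (k < k0)))%N.
  apply: leq_sum => k _; have kN := ltn_ord k.
  have -> : (N - (N - k.+1) = k.+1)%N by rewrite subKn.
  by case: (ltnP k.+1 k0) => // /ltnW ->.
have -> : (\sum_(k < N) (k < k0) = minn N k0)%N.
  elim: N => [|N IH]; first by rewrite big_ord0 min0n.
  by rewrite big_ord_recr/= IH; case: ltnP; lia.
exact: geq_minr.
Qed.

(** G^2 / (G + k)^2 is compared with the telescoping G^2 (1 / (G + k - 1) - 1 / (G + k)); the total
    is at most G^2 / (G - 1), and G >= 2 bounds it by 2 G. *)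
Lemma sum_inv_sq_le (G : R) N : 2 <= G ->
  \sum_(k < N) (1 + k%:R / G) ^- 2 <= 2 * G.
Proof.
move=> G2.
have G0 : 0 < G by lra.
have G1 : 0 < G - 1 by lra.
suff hn n : \sum_(k < n) (1 + k%:R / G) ^- 2 <= G ^+ 2 * ((G - 1)^-1 - (G + n%:R - 1)^-1).
  apply: (le_trans (hn N)).
  have ? : 0 <= (G + N%:R - 1)^-1 by rewrite invr_ge0; have := ler0n R N; lra.
  apply: (@le_trans _ _ (G ^+ 2 / (G - 1))).
    by rewrite ler_wpM2l ?sqr_ge0//; lra.
  by rewrite ler_pdivrMr// expr2; nra.
elim: n => [|n IHn]; first by rewrite big_ord0 addr0 subrr mulr0.
rewrite big_ord_recr/=; apply: (le_trans (lerD IHn (lexx _))).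
have n0R := ler0n R n.
rewrite -natr1; set x := n%:R in n0R *.
have Gx : 0 < G + x - 1 by lra.
have Gx1 : 0 < G + x by lra.
have -> : (1 + x / G) ^- 2 = G ^+ 2 * (G + x) ^- 2.
  by field; rewrite !gt_eqF// mulrC.
rewrite -mulrDr ler_wpM2l ?sqr_ge0//.
have -> : (G + (x + 1) - 1)^-1 = (G + x)^-1 by congr (_^-1); ring.
rewrite -addrA lerD2l addrC -lerBrDr opprK.
have -> : - (G + x)^-1 + (G + x - 1)^-1 = ((G + x) * (G + x - 1))^-1.
  by field; rewrite !gt_eqF.
by rewrite lef_pV2 ?posrE ?mulr_gt0 ?exprn_gt0// expr2 ler_pM2l//; lra.
Qed.

(** Put G = g(N) and B = (D / s) Q(s (1 + d / 2)). The far types above n0 contribute at most 2 G B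
    and those below at most n0 B <= G B, while h is at least eta G Q(s (1 + d / 2)); whence the
    constant 3 D / eta. The gain is the factor 1 / s. *)
Lemma lt_sum_ratios_tail d : 0 < d <= 1 -> exists2 D, 0 < D &
  \forall N \near \oo, forall s, 1 <= s ->
    \sum_(r <- ratios N | 1 + d < r) poisson_lt m.+1 (s * r) <= D / s * h N s.
Proof.
move=> /andP[d0 d1].
have [D D0 tailD] := poisson_lt_tail d0.
have [eta eta0 headN] : exists2 eta, 0 < eta & \forall N \near \oo, forall s, 0 <= s ->
    eta * g N%:R * poisson_lt m.+1 (s * (1 + d / 2)) <= h N s.
  by apply: lt_sum_ratios_ge; rewrite d0.
exists (3 * D / eta); first by rewrite divr_gt0// mulr_gt0.
near=> N => s s1.
have s0 : 0 < s by exact: lt_le_trans s1.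
have nN : (n0 <= N)%N by near: N; exact: nbhs_infty_ge.
have G2 : 2 <= g N%:R by near: N; move/cvgryPge: g_pinfty; apply.
have Gn0 : n0%:R <= g N%:R by near: N; move/cvgryPge: g_pinfty; apply.
have hd : eta * g N%:R * poisson_lt m.+1 (s * (1 + d / 2)) <= h N s.
  have hdN : forall s, 0 <= s ->
    eta * g N%:R * poisson_lt m.+1 (s * (1 + d / 2)) <= h N s by near: N.
  exact: hdN (ltW s0).
set q := poisson_lt m.+1 _ in hd.
have q0 : 0 <= q by rewrite poisson_lt_ge0// mulr_ge0 ?(ltW s0)//; lra.
set G := g N%:R in G2 Gn0 hd.
have G0 : 0 < G by lra.
pose B := D / s * q.
have B0 : 0 <= B by rewrite mulr_ge0// divr_ge0// ltW.
have DsE : 3 * D / eta / s * (eta * G * q) = 3 * G * B.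
  by rewrite /B; field; rewrite !gt_eqF.
have : 3 * D / eta / s * (eta * G * q) <= 3 * D / eta / s * h N s.
  by rewrite ler_wpM2l// !divr_ge0 ?mulr_ge0// ltW.
rewrite DsE; apply: le_trans.
rewrite /ratios big_map -[X in iota 0 X](subn0 N) -/(index_iota 0 N) big_mkord.
have term_le (k : 'I_N) : 1 + d < f N%:R / f (N - k)%:R ->
    poisson_lt m.+1 (s * (f N%:R / f (N - k)%:R)) <=
    B * (1 + k%:R / G) ^- 2 + B * (N - k < n0)%N%:R.
  set r := f N%:R / _ => dr.
  have r1 : 1 <= r by apply: ltW; apply: lt_trans dr; rewrite ltrDl.
  have r0 : 0 < r by exact: lt_le_trans r1.
  have rC0 : 0 < r ^+ (2 * C) by rewrite exprn_gt0.
  have := tailD s r s1 dr; rewrite -/q -/B -ler_pdivlMr// => /le_trans; apply.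
  have kG0 : 0 < 1 + k%:R / G by rewrite ltr_pwDl// divr_ge0// ltW.
  have [kn0|kn0] := ltnP (N - k)%N n0.
    rewrite /= mulr1; apply: (@le_trans _ _ B).
      by rewrite ler_pdivrMr// ler_peMr// exprn_ege1.
    by rewrite lerDr mulr_ge0// invr_ge0 exprn_ge0// ltW.
  rewrite /= mulr0 addr0 ler_wpM2l// lef_pV2 ?posrE ?exprn_gt0//.
  have n0k : n0%:R <= (N - k)%:R :> R by rewrite ler_nat.
  have := ratio_lower n0k (_ : (N - k)%:R <= N%:R); rewrite ler_nat leq_subr => /(_ isT).
  have kN := ltn_ord k.
  have Nk0 : 0 < (N - k)%:R :> R by rewrite ltr0n subn_gt0.
  have fk0 := f_gt0 Nk0.
  have -> : N%:R - (N - k)%:R = k%:R :> R by rewrite natrB ?(ltnW kN)// opprB addrC subrK.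
  have rN : f N%:R = r * f (N - k)%:R by rewrite /r divfK// gt_eqF.
  rewrite -/G rN exprMn mulrA ler_pM2r ?exprn_gt0// => hr.
  rewrite mulnC exprM lerXn2r ?nnegrE ?(ltW kG0) ?exprn_ge0 ?(ltW r0)//.
  rewrite -(ler_pM2l G0); apply: le_trans hr.
  rewrite mulrDr mulr1 mulrCA divff ?gt_eqF// mulr1 lerD2l ler_peMl//.
  by rewrite ler1n.
apply: (@le_trans _ _ (\sum_(k < N) (B * (1 + k%:R / G) ^- 2 + B * (N - k < n0)%N%:R))).
  rewrite big_mkcond/=; apply: ler_sum => k _; case: ifP => [|_]; first exact: term_le.
  by rewrite addr_ge0// mulr_ge0// invr_ge0 exprn_ge0// addr_ge0// divr_ge0// ltW.
rewrite big_split/= -!mulr_sumr.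
have cnt : \sum_(k < N) (N - k < n0)%N%:R <= n0%:R :> R.
  by rewrite -natr_sum ler_nat sum_near_end_le.
have := sum_inv_sq_le N G2; set S := \sum_(_ < _) _ => hS.
have : B * S <= B * (2 * G) by rewrite ler_wpM2l.
have : B * \sum_(k < N) (N - k < n0)%N%:R <= B * n0%:R by rewrite ler_wpM2l.
have : B * n0%:R <= B * G by rewrite ler_wpM2l.
by lra.
Unshelve. all: by end_near. Qed.

Lemma lt_sum_ratios_gt0 N s : (0 < N)%N -> 0 <= s -> 0 < h N s.
Proof.
case: N => // N _ s0; rewrite hE big_ord_recl ltr_pwDl//.
  by rewrite /term subn0 divff ?mulr1 ?poisson_lt_gt0// gt_eqF// f_gt0.
by apply: sumr_ge0 => k _; apply: term_ge0.
Qed.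

(** Only the ratios up to 1 + d are kept: there a shift by x costs at most exp(-x (1 + d)), and e
    bounds the discarded fraction. *)
Let lt_sum_ratios_lower N s x d e : 0 < d -> 0 <= x -> 0 <= s ->
  \sum_(r <- ratios N | 1 + d < r) poisson_lt m.+1 (s * r) <= e * h N s ->
  expR (- (x * (1 + d))) * ((1 - e) * h N s) <= h N (s + x).
Proof.
move=> d0 x0 s0 he.
rewrite [leRHS]/h /lt_sum (bigID (fun r => 1 + d < r))/=.
apply: (@le_trans _ _ (expR (- (x * (1 + d))) *
    \sum_(r <- ratios N | ~~ (1 + d < r)) poisson_lt m.+1 (s * r))).
  rewrite ler_wpM2l ?expR_ge0// mulrBl mul1r lerBlDr.
  rewrite {1}/h /lt_sum (bigID (fun r => 1 + d < r))/= addrC lerD2l.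
  by apply: le_trans he _.
apply: (@le_trans _ _ (\sum_(r <- ratios N | ~~ (1 + d < r)) poisson_lt m.+1 ((s + x) * r))).
  rewrite mulr_sumr big_seq_cond [leRHS]big_seq_cond.
  apply: ler_sum => r /andP[rN]; rewrite -leNgt => rd.
  have r1 := ratios_ge1 rN.
  have r0 : 0 < r by exact: lt_le_trans r1.
  apply: (@le_trans _ _ (expR (- ((s + x) * r - s * r)) * poisson_lt m.+1 (s * r))).
    rewrite ler_wpM2r ?poisson_lt_ge0 ?mulr_ge0 ?(ltW r0)// ler_expR lerN2.
    by rewrite mulrDl addrAC subrr add0r ler_wpM2l.
  by apply: poisson_lt_shift_ge; rewrite ?mulr_ge0 ?(ltW r0)// ler_wpM2r ?(ltW r0)// lerDl.
rewrite lerDr big_seq_cond; apply: sumr_ge0 => r /andP[rN _].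
have r1 := ratios_ge1 rN.
by rewrite poisson_lt_ge0// mulr_ge0 ?addr_ge0// (le_trans ler01).
Qed.

Lemma lt_sum_ratios_quotient (s : nat -> R) x : 0 <= x ->
  s N @[N --> \oo] --> +oo ->
  h N (s N + x) / h N (s N) @[N --> \oo] --> expR (- x).
Proof.
move=> x0 s_oo; apply/cvgrPdist_le => e e0.
have sV : (s N)^-1 @[N --> \oo] --> (0 : R).
  by apply/gtr0_cvgV0 => //; move/cvgryPgt: s_oo; apply.
have up : (1 + x / s N) ^+ m * expR (- x) @[N --> \oo] --> expR (- x).
  rewrite -[X in _ --> X]mul1r; apply: cvgMl.
  have h1 : 1 + x / s N @[N --> \oo] --> (1 : R).
    rewrite -[X in _ --> X]addr0 -[X in 1 + X](mulr0 x).
    by apply: cvgD; [exact: cvg_cst|apply: cvgMr; exact: sV].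
  by have := cvg_comp _ _ h1 (@exprn_continuous R m 1); rewrite expr1n.
(* This makes x d <= e / 2, which pays for exp(-x d) >= 1 - x d. The other e / 2 pays for the
   discarded fraction D / s. *)
pose d := Num.min 1 (e / (2 * (x + 1))).
have x1 : 0 < 2 * (x + 1) by rewrite mulr_gt0// ltr_wpDl.
have d0 : 0 < d by rewrite lt_min ltr01 divr_gt0.
have d1 : 0 < d <= 1 by rewrite d0 ge_min lexx.
have xd : x * d <= e / 2.
  have : d <= e / (2 * (x + 1)) by rewrite ge_min lexx orbT.
  move=> /(ler_wpM2l x0)/le_trans; apply.
  by rewrite mulrA ler_pdivrMr//; nra.
have [D D0 hD] := lt_sum_ratios_tail d1.
near=> N.
have N0 : (0 < N)%N by near: N; exact: nbhs_infty_gt.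
have s1 : 1 <= s N by near: N; move/cvgryPge: s_oo; apply.
have s0 : 0 < s N by exact: lt_le_trans s1.
have h0 : 0 < h N (s N) by apply: lt_sum_ratios_gt0 => //; exact: ltW.
have De : D / s N <= e / 2.
  rewrite ler_pdivrMr// mulrC -ler_pdivrMr ?divr_gt0//.
  by near: N; move/cvgryPge: s_oo; apply.
have Ds1 : D / s N <= 1.
  by rewrite ler_pdivrMr// mul1r; near: N; move/cvgryPge: s_oo; apply.
have upN : (1 + x / s N) ^+ m * expR (- x) <= expR (- x) + e.
  have : `|expR (- x) - (1 + x / s N) ^+ m * expR (- x)| <= e.
    by near: N; move/cvgrPdist_le: up; apply.
  by rewrite distrC ler_distl => /andP[].
have tailN : forall t, 1 <= t ->
    \sum_(r <- ratios N | 1 + d < r) poisson_lt m.+1 (t * r) <= D / t * h N t.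
  by near: N.
have lo := lt_sum_ratios_lower d0 x0 (ltW s0) (tailN _ s1).
have hi := lt_sum_shift_le m (@ratios_ge1 N) s0 (_ : s N <= s N + x).
rewrite lerDl x0 in hi; have {hi} := hi isT; rewrite -/(h N _) -/(h N _) => hi.
rewrite distrC ler_distl; apply/andP; split.
  rewrite ler_pdivlMr//; apply: le_trans lo; rewrite mulrA ler_wpM2r ?(ltW h0)//.
  have ex : expR (- (x * (1 + d))) = expR (- x) * expR (- (x * d)).
    by rewrite -expRD; congr expR; ring.
  have ed : 1 - x * d <= expR (- (x * d)) by exact: expR_ge1Dx.
  have e1 : 0 <= expR (- x) <= 1 by rewrite expR_ge0 expR_le1 oppr_le0.
  have xd0 : 0 <= x * d by rewrite mulr_ge0// ltW.
  have Ds0 : 0 <= D / s N by rewrite divr_ge0// ltW.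
  rewrite ex; set u := expR (- x) in e1 *; set v := expR (- (x * d)) in ed *.
  set w := D / s N in De Ds0 *; set t := x * d in xd ed xd0 *.
  have /andP[u0 u1] := e1.
  have vw : (1 - t) * (1 - w) <= v * (1 - w) by rewrite ler_wpM2r// subr_ge0.
  have : u * (1 - e) <= u * (v * (1 - w)).
    by rewrite ler_wpM2l//; apply: le_trans vw; nra.
  by rewrite mulrA; nra.
rewrite ler_pdivrMr//; apply: (le_trans hi); rewrite ler_wpM2r ?(ltW h0)//.
have -> : (s N + x) / s N = 1 + x / s N by rewrite mulrDl divff// gt_eqF.
by rewrite [s N + x]addrC addrK.
Unshelve. all: by end_near. Qed.

Lemma exists_center N : (0 < N)%N -> exists2 c, 0 <= c & h N c = 1.
Proof.
move=> N0; have N0R : 0 < N%:R :> R by rewrite ltr0n.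
have [S S0 hS] : exists2 S, 0 <= S & h N S <= 1.
  have : \forall u \near +oo, poisson_lt m.+1 u <= N%:R^-1 :> R.
    have := @poisson_lt_cvg0 R m => /cvgrPdist_le /(_ N%:R^-1).
    rewrite invr_gt0 => /(_ N0R); apply: filterS => u.
    by rewrite sub0r normrN; apply: le_trans; exact: ler_norm.
  move=> H; near +oo_R => S; exists S; first by near: S; exact: nbhs_pinfty_ge.
  apply: le_trans (lt_sum_le_size m (@ratios_ge1 N) _) _; first by near: S; exact: nbhs_pinfty_ge.
  rewrite size_ratios mulrC -ler_pdivlMr// mul1r.
  by near: S.
have cont : {within `[0, S], continuous (h N)}.
  by apply: continuous_subspaceT; exact: continuous_lt_sum.
have hh0 : 1 <= h N 0.
  rewrite hE (eq_bigr (fun=> 1)) => [|k _]; last by rewrite /term mul0r poisson_lt0r.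
  by rewrite sumr_const card_ord ler1n.
have v1 : Num.min (h N 0) (h N S) <= 1 <= Num.max (h N 0) (h N S).
  by rewrite ge_min hS orbT le_max hh0.
have [c cS hc] := IVT S0 cont v1.
by exists c => //; move: cS; rewrite in_itv => /andP[].
Unshelve. all: by end_near. Qed.

(** At a fixed S, h_N(S) is at least a positive constant times g(N), hence eventually exceeds 1;
    since h_N is nonincreasing, the centre lies beyond S. *)
Lemma center_pinfty (c : nat -> R) :
  (forall N, (0 < N)%N -> 0 <= c N /\ h N (c N) = 1) -> c N @[N --> \oo] --> +oo.
Proof.
move=> hc; apply/cvgryPge => A.
pose S := Num.max A 0.
have S0 : 0 <= S by rewrite le_max lexx orbT.
have d1 : 0 < (1 : R) <= 1 by rewrite ltr01 /=.
have [eta eta0 headN] := lt_sum_ratios_ge d1.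
pose q := poisson_lt m.+1 (S * (1 + 1 / 2)).
have q0 : 0 < q by rewrite poisson_lt_gt0// mulr_ge0// addr_ge0// divr_ge0.
near=> N; have N0 : (0 < N)%N by near: N; exact: nbhs_infty_gt.
have [cN0 hcN] := hc N N0.
have hS : 1 < h N S.
  have hN : forall s, 0 <= s ->
    eta * g N%:R * poisson_lt m.+1 (s * (1 + 1 / 2)) <= h N s by near: N.
  apply: lt_le_trans (hN _ S0); rewrite -/q mulrAC.
  rewrite mulrC -ltr_pdivrMr; last exact: mulr_gt0.
  rewrite mul1r.
  by near: N; move/cvgryPgt: g_pinfty; apply.
apply: (@le_trans _ _ S); first by rewrite le_max lexx.
rewrite leNgt; apply/negP => cS.
by have := le_lt_sum m (@ratios_ge1 N) cN0 (ltW cS); rewrite -/(h _ _) -/(h _ _) hcN leNgt hS.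
Unshelve. all: by end_near. Qed.

(** From 1 = h_N(c) <= N Q(c) and c^2 Q(c) <= K follows c^2 <= K N, so c / N <= K / c. *)
Lemma center_div_cvg0 (c : nat -> R) :
  (forall N, (0 < N)%N -> 0 <= c N /\ h N (c N) = 1) ->
  c N / N%:R @[N --> \oo] --> (0 : R).
Proof.
move=> hc; have c_oo := center_pinfty hc.
have [K K0 hK] := @poisson_lt_decay R m 2.
have cV : (c N)^-1 @[N --> \oo] --> (0 : R).
  by apply/gtr0_cvgV0 => //; move/cvgryPgt: c_oo; apply.
apply: (@squeeze_cvgr _ _ _ _ (fun=> 0) (fun N => K * (c N)^-1)); last 2 first.
- exact: cvg_cst.
- by rewrite -(mulr0 K); apply: cvgMr; exact: cV.
near=> N; have N0 : (0 < N)%N by near: N; exact: nbhs_infty_gt.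
have N0R : 0 < N%:R :> R by rewrite ltr0n.
have [cN0 hcN] := hc N N0.
have c0 : 0 < c N by near: N; move/cvgryPgt: c_oo; apply.
rewrite divr_ge0//= ler_pdivrMr// mulrAC ler_pdivlMr// -expr2.
have := lt_sum_le_size m (@ratios_ge1 N) cN0.
rewrite -/(h _ _) hcN size_ratios => h1.
have := hK _ cN0; set q := poisson_lt _ _ in h1 *; set t := c N ^+ 2 => h2.
have t0 : 0 <= t by rewrite sqr_ge0.
apply: (@le_trans _ _ (N%:R * (t * q))); first by rewrite mulrCA ler_peMr.
by rewrite mulrC ler_wpM2r// ltW.
Unshelve. all: by end_near. Qed.

Lemma center_lt_sum_cvg (c : nat -> R) x :
  (forall N, (0 < N)%N -> 0 <= c N /\ h N (c N) = 1) ->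
  h N (c N + x) @[N --> \oo] --> expR (- x).
Proof.
move=> hc; have c_oo := center_pinfty hc.
have [x0|x0] := leP 0 x.
  have := lt_sum_ratios_quotient x0 c_oo; apply: cvg_trans; apply: near_eq_cvg.
  near=> N; have N0 : (0 < N)%N by near: N; exact: nbhs_infty_gt.
  by have [_ ->] := hc N N0; rewrite divr1.
(* For negative x the quotient is based at c N + x and shifted by -x back to the centre, where h is
   1; its inverse is the wanted value. *)
have cx_oo : c N + x @[N --> \oo] --> +oo by exact: (cvg_comp _ _ c_oo (cvg_addrr x)).
have nx0 : 0 <= - x by rewrite oppr_ge0 ltW.
have := lt_sum_ratios_quotient nx0 cx_oo; rewrite opprK => hq.
have e0 : expR x != 0 by rewrite gt_eqF ?expR_gt0.
have hV : (h N (c N + x - x) / h N (c N + x))^-1 @[N --> \oo] --> expR (- x).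
  by rewrite expRN; exact: cvgV hq.
apply: cvg_trans hV; apply: near_eq_cvg.
near=> N; have N0 : (0 < N)%N by near: N; exact: nbhs_infty_gt.
by have [_ hN] := hc N N0; rewrite /= addrK hN mul1r invrK.
Unshelve. all: by end_near. Qed.

End fixed_m.

End ratio_estimates.

(** * Poissonization *)

(** The requirement left after drawing type j. The subtraction is truncated, so a surplus coupon
    changes nothing. *)
Definition dec (mu : nat -> nat) (j i : nat) : nat := (mu i - (i == j))%N.

Section poissonization.
Context {R : realType}.
Variables (s : seq nat) (p : nat -> R).
Hypothesis s_uniq : uniq s.
Hypothesis p_ge0 : {in s, forall j, 0 <= p j}.
Hypothesis p_sum : \sum_(j <- s) p j = 1.
Implicit Types (M mu : nat -> nat) (n k : nat).

(* The probability that n draws contain every type j of s at least mu j times,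
   computed by conditioning on the first draw. *)
Fixpoint fill_prob n mu : R :=
  if n is n'.+1 then \sum_(j <- s) p j * fill_prob n' (dec mu j)
  else (all (fun j => mu j == 0) s)%N%:R.

Lemma fill_prob01 n mu : 0 <= fill_prob n mu <= 1.
Proof.
elim: n mu => [|n IHn] mu /=; first by case: all => //=; rewrite ?lexx ?ler01.
apply/andP; split.
  rewrite big_seq sumr_ge0// => j js; rewrite mulr_ge0 ?p_ge0//.
  by have /andP[] := IHn (dec mu j).
rewrite -p_sum big_seq [leRHS]big_seq; apply: ler_sum => j js.
by rewrite ler_piMr ?p_ge0//; have /andP[] := IHn (dec mu j).
Qed.

(** The exponential series of a X without its terms below degree k, cut at degree K: the exponential
    generating function of one type of which k copies are required. *)
Let expoly (K k : nat) (a : R) : {poly R} :=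
  \poly_(i < K.+1) (if (k <= i)%N then a ^+ i / i`!%:R else 0).

Let P M mu : {poly R} := \prod_(j <- s) expoly (M j) (mu j) (p j).

Let deriv_expoly K k a : (expoly K.+1 k a)^`() = a *: expoly K k.-1 a.
Proof.
apply/polyP => i; rewrite coef_deriv coefZ !coef_poly ltnS.
case: ltnP => _; last by rewrite mulr0 mul0rn.
have -> : (k <= i.+1)%N = (k.-1 <= i)%N by case: k.
case: ifP => _; last by rewrite mulr0 mul0rn.
rewrite exprS factS natrM -mulr_natr.
by field; rewrite -(natrD _ 1) !pnatr_eq0 -lt0n fact_gt0.
Qed.

(** The product rule mirrors the recursion of [fill_prob]: differentiating the factor j corresponds
    to a first draw of type j. *)
Let deriv_prod_expoly (r : seq nat) M mu : uniq r -> {in r, forall j, 0 < M j}%N ->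
  (\prod_(j <- r) expoly (M j) (mu j) (p j))^`() =
  \sum_(j <- r) p j *: \prod_(i <- r) expoly (dec M j i) (dec mu j i) (p i).
Proof.
elim: r => [|a r IHr]; first by rewrite !big_nil -polyC1 derivC.
rewrite cons_uniq => /andP[ar ur] Mr.
have Ma : (0 < M a)%N by apply: Mr; rewrite mem_head.
rewrite big_cons derivM IHr//; last by move=> j jr; apply: Mr; rewrite inE jr orbT.
rewrite [RHS]big_cons big_cons; congr (_ + _).
  have -> : dec M a a = (M a).-1 by rewrite /dec eqxx subn1.
  have -> : dec mu a a = (mu a).-1 by rewrite /dec eqxx subn1.
  rewrite -[in LHS](prednK Ma) deriv_expoly scalerAl; congr (_ * _).
  apply: eq_big_seq => i ir; rewrite /dec.
  by rewrite (_ : (i == a) = false) ?subn0//; apply: contraNF ar => /eqP <-.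
rewrite mulr_sumr; apply: eq_big_seq => j jr.
have aj : (a == j) = false by apply: contraNF ar => /eqP ->.
by rewrite big_cons /dec aj !subn0 scalerAr.
Qed.

(* Differentiating one factor lowers both its truncation order and its lower
   index by one, which is why the truncation M depends on j. *)
Let fill_prob_coef n M mu : {in s, forall j, n <= M j}%N ->
  n`!%:R * (P M mu)`_n = fill_prob n mu.
Proof.
elim: n M mu => [|n IHn] M mu nM.
  rewrite fact0 mul1r -horner_coef0 horner_prod /=.
  rewrite (eq_big_seq (fun j => (mu j == 0)%N%:R)) => [|j js]; last first.
    rewrite horner_coef0 coef_poly /= leqn0.
    by case: ifP => // _; rewrite expr0 fact0 divr1.
  elim: s => [|a r IH]; first by rewrite big_nil.
  by rewrite big_cons IH/= -natrM mulnb.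
have -> : n.+1`!%:R * (P M mu)`_n.+1 = n`!%:R * ((P M mu)^`())`_n.
  by rewrite coef_deriv factS natrM -mulr_natr; ring.
rewrite /P deriv_prod_expoly//; last by move=> j /nM; exact: leq_ltn_trans.
rewrite coef_sum mulr_sumr /=; apply: eq_big_seq => j js.
rewrite coefZ mulrCA; congr (_ * _); apply: IHn => i si; rewrite /dec.
by case: (i == j); rewrite ?subn0 ?subn1; [have := nM _ si; case: (M i)|exact/ltnW/nM].
Qed.

Let expoly_ge0 K k (a : R) i : 0 <= a -> 0 <= (expoly K k a)`_i.
Proof.
by move=> a0; rewrite coef_poly; case: ifP => // _; case: ifP => // _; rewrite divr_ge0 ?exprn_ge0.
Qed.

Let prod_expoly_mono (r : seq nat) K L mu i : {in r, forall j, 0 <= p j} -> (K <= L)%N ->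
  0 <= (\prod_(j <- r) expoly K (mu j) (p j))`_i <=
       (\prod_(j <- r) expoly L (mu j) (p j))`_i.
Proof.
move=> + KL; elim: r i => [|a r IHr] i pr; first by rewrite !big_nil coef1 ler0n lexx.
have pa : 0 <= p a by apply: pr; rewrite mem_head.
have {}IHr i := IHr i (fun j jr => pr j (mem_behead (s := a :: r) jr)).
rewrite !big_cons !coefM; apply/andP; split.
  apply: sumr_ge0 => k _; rewrite mulr_ge0 ?expoly_ge0//.
  by have /andP[] := IHr (i - k)%N.
apply: ler_sum => k _; have /andP[h1 h2] := IHr (i - k)%N.
apply: ler_pM => //; first exact: expoly_ge0.
have hL := expoly_ge0 L (mu a) k pa; move: hL.
rewrite !coef_poly !ltnS; case: (leqP k K) => // kK.
by rewrite (leq_trans kK KL).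
Qed.

Lemma poisson_mixture_partial (t : R) mu K : 0 <= t ->
  \sum_(n < K) t ^+ n / n`!%:R * fill_prob n mu <= (P (fun=> K) mu).[t].
Proof.
move=> t0.
have E n : (n < K)%N -> t ^+ n / n`!%:R * fill_prob n mu = (P (fun=> K) mu)`_n * t ^+ n.
  move=> nK; rewrite -(@fill_prob_coef n (fun=> K)) => [|j js]; last exact: ltnW.
  by field; rewrite pnatr_eq0 -lt0n fact_gt0.
rewrite (eq_bigr (fun n : 'I_K => (P (fun=> K) mu)`_n * t ^+ n)) => [|n _]; last exact: E.
have PK n : 0 <= (P (fun=> K) mu)`_n.
  by have /andP[] := prod_expoly_mono mu n p_ge0 (leqnn K).
have [sK|sK] := leqP (size (P (fun=> K) mu)) K.
  by rewrite (horner_coef_wide _ sK).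
rewrite horner_coef (big_ord_widen _ (fun n => (P (fun=> K) mu)`_n * t ^+ n) (ltnW sK)).
rewrite big_mkcond/=; apply: ler_sum => n _; case: ifP => // _.
by rewrite mulr_ge0// exprn_ge0.
Qed.

Lemma poisson_mixture_partial_ge (t : R) mu K : 0 <= t ->
  exists L, (P (fun=> K) mu).[t] <= \sum_(n < L) t ^+ n / n`!%:R * fill_prob n mu.
Proof.
move=> t0; pose L := maxn K (size (P (fun=> K) mu)).
exists L; rewrite (horner_coef_wide _ (leq_maxr K _)).
apply: ler_sum => n _; rewrite -(@fill_prob_coef n (fun=> L)) => [|j js]; last exact/ltnW/ltn_ord.
have -> : t ^+ n / n`!%:R * (n`!%:R * (P (fun=> L) mu)`_n) = (P (fun=> L) mu)`_n * t ^+ n.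
  by field; rewrite pnatr_eq0 -lt0n fact_gt0.
rewrite ler_wpM2r ?exprn_ge0//.
by have /andP[] := prod_expoly_mono mu n p_ge0 (leq_maxl K (size (P (fun=> K) mu))).
Qed.

Let expoly_cvg k (a t : R) :
  (expoly K k a).[t] @[K --> \oo] --> expR (a * t) - exp_partial k (a * t).
Proof.
have h : \sum_(i < K.+1) (a * t) ^+ i / i`!%:R - exp_partial k (a * t) @[K --> \oo] -->
    expR (a * t) - exp_partial k (a * t).
  apply: cvgB; last exact: cvg_cst.
  have h : series (exp_coeff (a * t)) @ \oo --> expR (a * t).
    exact: is_cvg_series_exp_coeff.
  rewrite -cvg_shiftS in h; apply: cvg_trans h; apply: near_eq_cvg; apply: nearW => K.
  by rewrite /= /series/= big_mkord.
apply: cvg_trans h; apply: near_eq_cvg; near=> K.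
rewrite horner_poly /exp_partial.
have kK : (k <= K.+1)%N by near: K; exists k => // K /= /leqW.
rewrite (big_ord_widen _ (fun i => (a * t) ^+ i / i`!%:R) kK) [X in _ - X]big_mkcond/=.
rewrite -sumrB; apply: eq_bigr => i _; case: ltnP => _; rewrite ?subrr ?mul0r// subr0.
by rewrite exprMn; ring.
Unshelve. all: by end_near. Qed.

(** The product of truncated series is not a partial sum of the mixture, but its coefficients are
    nonnegative, nondecreasing in the truncation and correct up to its order. Products and partial
    sums therefore interlace and share their limit, which is computed factor by factor. *)
Lemma poisson_mixture (t : R) mu : 0 <= t ->
  \sum_(n < K) t ^+ n / n`!%:R * fill_prob n mu @[K --> \oo] -->
  \prod_(j <- s) (expR (p j * t) - exp_partial (mu j) (p j * t)).
Proof.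
move=> t0; set l := \prod_(j <- s) _.
have Pl : (P (fun=> K) mu).[t] @[K --> \oo] --> l.
  rewrite /l; under eq_fun do rewrite horner_prod.
  apply: cvg_big; first exact: mul_continuous.
  by move=> j _; exact: expoly_cvg.
set u := fun K : nat => _.
have term0 n : 0 <= t ^+ n / n`!%:R * fill_prob n mu.
  by rewrite mulr_ge0 ?divr_ge0 ?exprn_ge0//; have /andP[] := fill_prob01 n mu.
have u_nd : nondecreasing_seq u.
  by apply/nondecreasing_seqP => K; rewrite /u big_ord_recr/= lerDl.
have uP K : u K <= (P (fun=> K) mu).[t] by exact: poisson_mixture_partial.
have cu : cvgn u.
  apply: nondecreasing_is_cvgn => //.
  have [B [_ hB]] := cvg_seq_bounded (cvgP _ Pl).
  exists (B + 1) => _ [K _ <-]; apply: (le_trans (uP K)).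
  by apply: le_trans (ler_norm _) (hB (B + 1) _ K I); rewrite ltrDl.
have -> : l = limn u; last exact: cu.
apply/eqP; rewrite eq_le; apply/andP; split; last first.
  rewrite -(cvg_lim _ Pl)//; apply: ler_lim => //; first exact: cvgP Pl.
  exact: nearW.
rewrite -(cvg_lim _ Pl)//; apply: limr_le; first exact: cvgP Pl.
apply: nearW => K; have [L hL] := poisson_mixture_partial_ge mu K t0.
apply: (le_trans hL); exact: nondecreasing_cvgn_le.
Qed.

End poissonization.

(** * Gamma integrals and the moments of the maximum *)

Section gamma_integrals.
Context {R : realType}.
Local Notation mu := (@lebesgue_measure R).
Implicit Types (b x : R) (n : nat).

Let gamma_ge0 b n x : 0 <= b -> 0 <= x -> 0 <= expR (- (b * x)) * ((b * x) ^+ n / n`!%:R).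
Proof.
by move=> b0 x0; rewrite mulr_ge0 ?expR_ge0// divr_ge0// exprn_ge0// mulr_ge0.
Qed.

Let continuous_gamma b n : continuous (fun x => expR (- (b * x)) * ((b * x) ^+ n / n`!%:R)).
Proof.
move=> x.
have cb : b * y @[y --> x] --> b * x by exact: mulrl_continuous.
have cNb : - (b * y) @[y --> x] --> - (b * x) by apply: cvgN.
apply: cvgM; first exact: (cvg_comp _ _ cNb (@continuous_expR R _)).
by apply: cvgMl; apply: (cvg_comp _ _ cb (@exprn_continuous R n _)).
Qed.

Lemma integral_gamma b n : 0 < b ->
  (\int[mu]_(x in `[0%R, +oo[) (expR (- (b * x)) * ((b * x) ^+ n / n`!%:R))%:E = (b^-1)%:E)%E.
Proof.
move=> b0.
pose F x := - b^-1 * poisson_lt n.+1 (b * x).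
have dF x : is_derive x 1 F (expR (- (b * x)) * ((b * x) ^+ n / n`!%:R)).
  have dp := is_derive_poisson_lt n (b * x).
  have dc := @is_derive1_comp R (poisson_lt n.+1) (fun y => b * y) x _ _ dp (is_derive_mull b x).
  have := is_deriveM (is_derive_cst (- b^-1) x 1) dc.
  rewrite !fctE /GRing.scale/= mulr0 addr0 => /is_derive_eq; apply.
  by field; rewrite !gt_eqF ?ltr0n ?fact_gt0.
rewrite (@ge0_continuous_FTC2y _ _ F 0 0).
- by rewrite /F mulr0 poisson_lt0r mulr1 -EFinB sub0r opprK.
- by move=> x x0; apply: gamma_ge0 => //; exact: ltW.
- by apply: continuous_subspaceT; exact: continuous_gamma.
- rewrite /F -(mulr0 (- b^-1)); apply: cvgMr.
  have bx : b * x @[x --> +oo] --> +oo by exact: gt0_cvgMry.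
  exact: (cvg_comp _ _ bx (poisson_lt_cvg0 n)).
- by move=> x _; have dFx := dF x; exact: ex_derive.
- apply: cvg_at_right_filter; apply: differentiable_continuous.
  by apply/derivable1_diffP; have dFx := dF 0; exact: ex_derive.
- by move=> x _; have dFx := dF x; rewrite derive1E derive_val.
Qed.

(** x times the Gamma density of index n is (n + 1) / b times the one of index n + 1. *)
Lemma integral_id_gamma b n : 0 < b ->
  (\int[mu]_(x in `[0%R, +oo[) (x * (expR (- (b * x)) * ((b * x) ^+ n / n`!%:R)))%:E =
   (n.+1%:R / b ^+ 2)%:E)%E.
Proof.
move=> b0.
have E x : x * (expR (- (b * x)) * ((b * x) ^+ n / n`!%:R)) =
   n.+1%:R / b * (expR (- (b * x)) * ((b * x) ^+ n.+1 / n.+1`!%:R)).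
  rewrite exprS factS natrM; field.
  by rewrite !gt_eqF ?ltr0n ?fact_gt0// -(natrD _ 1) ltr0n.
under eq_integral do rewrite E EFinM.
rewrite ge0_integralZl_EFin//=; last 3 first.
- by move=> x /=; rewrite in_itv/= andbT => x0; rewrite lee_fin gamma_ge0// ltW.
- apply/measurable_EFinP; apply: measurable_funTS.
  by apply: continuous_measurable_fun; exact: continuous_gamma.
- by rewrite divr_ge0// ltW.
by rewrite integral_gamma// -EFinM; congr EFin; field; rewrite gt_eqF.
Qed.

Lemma integrable_onem_max_cdf m (rs : seq R) : {in rs, forall r, 1 <= r} ->
  mu.-integrable `[0%R, +oo[ (EFin \o (fun s => 1 - max_cdf m.+1 rs s)) /\
  mu.-integrable `[0%R, +oo[ (EFin \o (fun s => s * (1 - max_cdf m.+1 rs s))).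
Proof.
move=> rs1.
(* The factors come from the number of ratios, from [exp_partial m.+1 s] <= (m + 1) (1 + s)^m, and
   from [expRN_half_bound] at m + 1. Bounding (1 + s) (1 - F) treats both integrands at once. *)
pose K : R := (size rs)%:R * (m.+1%:R * (expR 2^-1 * (2 ^+ m.+1 * m.+1`!%:R))).
have bnd s : 0 <= s -> (1 + s) * (1 - max_cdf m.+1 rs s) <= K * expR (- 2^-1 * `|s|).
  move=> s0; rewrite (ger0_norm s0).
  have s1 : 0 <= 1 + s by rewrite addr_ge0.
  apply: le_trans (ler_wpM2l s1 (onem_max_cdf_le m rs1 s0)) _.
  apply: le_trans (ler_wpM2l s1 (lt_sum_le_size m rs1 s0)) _.
  rewrite /K mulrCA -!mulrA; apply: ler_wpM2l => //.
  have ep : exp_partial m.+1 s <= m.+1%:R * (1 + s) ^+ m.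
    rewrite mulr_natl -[m.+1 in leRHS]card_ord -sumr_const; apply: ler_sum => i _.
    apply: (@le_trans _ _ (s ^+ i)).
      by rewrite ler_pdivrMr ?ltr0n ?fact_gt0// ler_peMr ?exprn_ge0// ler1n fact_gt0.
    apply: (@le_trans _ _ ((1 + s) ^+ i)); first by rewrite lerXn2r ?nnegrE// lerDr.
    by rewrite ler_weXn2l ?lerDl// -ltnS.
  apply: (@le_trans _ _ (m.+1%:R * ((1 + s) ^+ m.+1 * expR (- s)))); last first.
    by rewrite ler_wpM2l// !mulrA; have := expRN_half_bound m.+1 s0; rewrite !mulrA.
  rewrite /poisson_lt exprS.
  have -> : m.+1%:R * ((1 + s) * (1 + s) ^+ m * expR (- s)) =
    (1 + s) * (expR (- s) * (m.+1%:R * (1 + s) ^+ m)) by ring.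
  by rewrite ler_wpM2l// ler_wpM2l ?expR_ge0.
have iK : mu.-integrable `[0%R, +oo[ (EFin \o (fun s => K * expR (- 2^-1 * `|s|))).
  apply: (integrableS measurableT) => //.
  rewrite (_ : _ \o _ = (fun x => K%:E * (expR (- 2^-1 * `|x|))%:E)%E)//.
  by apply: integrableZl => //; apply: integrable_expRN_norm; rewrite invr_gt0.
have mF : measurable_fun setT (fun s => 1 - max_cdf m.+1 rs s).
  by apply: measurable_funB => //; apply: continuous_measurable_fun; exact: continuous_max_cdf.
have F0 s : 0 <= s -> 0 <= 1 - max_cdf m.+1 rs s.
  by move=> s0; rewrite subr_ge0; have /andP[] := max_cdf01 m rs1 s0.
split.
- apply: (le_integrable _ _ _ iK) => //.
    by apply/measurable_EFinP; exact: measurable_funTS.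
  move=> s /=; rewrite in_itv/= andbT => s0; rewrite lee_fin.
  rewrite ger0_norm ?F0//; apply: le_trans (ler_norm _); apply: le_trans (bnd s s0).
  by rewrite ler_peMl ?F0// lerDl.
- apply: (le_integrable _ _ _ iK) => //.
    by apply/measurable_EFinP; apply: measurable_funTS; exact: measurable_funM.
  move=> s /=; rewrite in_itv/= andbT => s0; rewrite lee_fin.
  rewrite ger0_norm ?mulr_ge0 ?F0//; apply: le_trans (ler_norm _); apply: le_trans (bnd s s0).
  by rewrite ler_wpM2r ?F0// lerDr.
Qed.

Section collector.
Variables (s : seq nat) (p : nat -> R) (b : R) (m : nat).
Hypothesis s_uniq : uniq s.
Hypothesis p_ge0 : {in s, forall j, 0 <= p j}.
Hypothesis p_sum : \sum_(j <- s) p j = 1.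
Hypothesis b_gt0 : 0 < b.

Let a n : R := 1 - fill_prob s p n (fun=> m).

Let a_ge0 n : 0 <= a n.
Proof.
by rewrite subr_ge0; have /andP[] := fill_prob01 p_ge0 p_sum n (fun=> m).
Qed.

Let rs : seq R := [seq b * p j | j <- s].

(** Since the p_j sum to 1, exp(-t) with t = b x distributes over the product as the exp(-p_j t),
    and each factor becomes 1 - Q(p_j t). *)
Let mixture x : 0 <= x ->
  \sum_(n < K) expR (- (b * x)) * ((b * x) ^+ n / n`!%:R) * a n @[K --> \oo] -->
  1 - max_cdf m rs x.
Proof.
move=> x0; set t := b * x; have t0 : 0 <= t by rewrite mulr_ge0// ltW.
have hexp : \sum_(n < K) t ^+ n / n`!%:R @[K --> \oo] --> expR t.
  have h : series (exp_coeff t) @ \oo --> expR t by exact: is_cvg_series_exp_coeff.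
  apply: cvg_trans h; apply: near_eq_cvg; apply: nearW => K.
  by rewrite /series/= big_mkord.
have hfill := @poisson_mixture _ _ _ s_uniq p_ge0 p_sum _ (fun=> m) t0.
have h : expR (- t) * (\sum_(n < K) t ^+ n / n`!%:R -
    \sum_(n < K) t ^+ n / n`!%:R * fill_prob s p n (fun=> m)) @[K --> \oo] -->
    expR (- t) * (expR t - \prod_(j <- s) (expR (p j * t) - exp_partial m (p j * t))).
  by apply: cvgMr; apply: cvgB.
have -> : 1 - max_cdf m rs x =
    expR (- t) * (expR t - \prod_(j <- s) (expR (p j * t) - exp_partial m (p j * t))).
  rewrite mulrBr expRN mulVf ?gt_eqF ?expR_gt0//; congr (_ - _).
  have tE : - t = \sum_(j <- s) - (p j * t) by rewrite sumrN -mulr_suml p_sum mul1r.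
  rewrite -expRN tE expR_sum -big_split/= /max_cdf big_map; apply: eq_bigr => j _.
  rewrite mulrBr -expRD addNr expR0; congr (1 - _).
  by rewrite /poisson_lt /t; congr (expR (- _) * exp_partial _ _); ring.
apply: cvg_trans h; apply: near_eq_cvg; apply: nearW => K.
by rewrite -sumrB mulr_sumr; apply: eq_bigr => n _; rewrite /a; ring.
Qed.

Let mixture_series (g : R -> R) x : 0 <= x -> 0 <= g x ->
  (\sum_(n <oo) (g x * (expR (- (b * x)) * ((b * x) ^+ n / n`!%:R)) * a n)%:E =
   (g x * (1 - max_cdf m rs x))%:E)%E.
Proof.
move=> x0 gx0; apply: cvg_lim => //.
have h : (g x * \sum_(n < K) expR (- (b * x)) * ((b * x) ^+ n / n`!%:R) * a n)%:E
    @[K --> \oo] --> (g x * (1 - max_cdf m rs x))%:E.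
  by apply: cvg_EFin; [exact: nearW|apply: cvgMr; exact: mixture].
apply: cvg_trans h; apply: near_eq_cvg; apply: nearW => K.
rewrite sumEFin big_mkord mulr_sumr; congr EFin.
by apply: eq_bigr => n _; rewrite mulrA.
Qed.

(** Nonnegativity allows the mixture to be integrated term by term. As a n is the probability that n
    draws do not suffice, the series is E[T] / b; the weighted integral below is E[T(T+1)] / (2 b^2)
    in the same way. *)
Lemma integral_onem_max_cdf :
  (\int[mu]_(x in `[0%R, +oo[) (1 - max_cdf m rs x)%:E =
   \sum_(n <oo) (a n / b)%:E)%E.
Proof.
have mg n : measurable_fun (`[0%R, +oo[ : set R)
    (fun x => (1 * (expR (- (b * x)) * ((b * x) ^+ n / n`!%:R)) * a n)%:E).
  apply/measurable_EFinP; apply: measurable_funTS; apply: measurable_funM => //.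
  by apply: measurable_funM => //; apply: continuous_measurable_fun; exact: continuous_gamma.
transitivity (\int[mu]_(x in `[0%R, +oo[)
    (\sum_(n <oo) (1 * (expR (- (b * x)) * ((b * x) ^+ n / n`!%:R)) * a n)%:E))%E.
  apply: eq_integral => x; rewrite inE/= in_itv/= andbT => x0.
  by rewrite (mixture_series (g := fun=> 1))// mul1r.
rewrite integral_nneseries//; last first.
  move=> n x /=; rewrite in_itv/= andbT => x0.
  by rewrite lee_fin mul1r mulr_ge0// gamma_ge0// ltW.
apply: eq_eseriesr => n _.
under eq_integral do rewrite mul1r mulrC EFinM.
rewrite ge0_integralZl_EFin//=; last 2 first.
- by move=> x /=; rewrite in_itv/= andbT => x0; rewrite lee_fin gamma_ge0// ltW.
- apply/measurable_EFinP; apply: measurable_funTS.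
  by apply: continuous_measurable_fun; exact: continuous_gamma.
by rewrite integral_gamma// -EFinM.
Qed.

Lemma integral_id_onem_max_cdf :
  (\int[mu]_(x in `[0%R, +oo[) (x * (1 - max_cdf m rs x))%:E =
   \sum_(n <oo) (a n * n.+1%:R / b ^+ 2)%:E)%E.
Proof.
have mg n : measurable_fun (`[0%R, +oo[ : set R)
    (fun x => (x * (expR (- (b * x)) * ((b * x) ^+ n / n`!%:R)) * a n)%:E).
  apply/measurable_EFinP; apply: measurable_funTS; apply: measurable_funM => //.
  by apply: measurable_funM => //; apply: continuous_measurable_fun; exact: continuous_gamma.
transitivity (\int[mu]_(x in `[0%R, +oo[)
    (\sum_(n <oo) (x * (expR (- (b * x)) * ((b * x) ^+ n / n`!%:R)) * a n)%:E))%E.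
  apply: eq_integral => x; rewrite inE/= in_itv/= andbT => x0.
  by rewrite (mixture_series (g := id)).
rewrite integral_nneseries//; last first.
  move=> n x /=; rewrite in_itv/= andbT => x0.
  by rewrite lee_fin mulr_ge0// mulr_ge0// gamma_ge0// ltW.
apply: eq_eseriesr => n _.
under eq_integral do rewrite mulrC EFinM.
rewrite ge0_integralZl_EFin//=; last 2 first.
- move=> x /=; rewrite in_itv/= andbT => x0.
  by rewrite lee_fin mulr_ge0// gamma_ge0// ltW.
- apply/measurable_EFinP; apply: measurable_funTS; apply: measurable_funM => //.
  by apply: continuous_measurable_fun; exact: continuous_gamma.
by rewrite integral_id_gamma// -EFinM mulrA.
Qed.

End collector.
End gamma_integrals.

(** * The variance of the completion time *)

Section coupon_probability.
Context (d : measure_display) (Omega : measurableType d) (R : realType).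
Variables (P : probability Omega R) (N : nat) (p : nat -> R).
Variable X : nat -> {RV P >-> nat}.
Hypothesis draws : coupon_draws N p X.
Hypothesis p_ge0 : {in iota 1 N, forall j, 0 <= p j}.
Hypothesis p_sum : \sum_(j <- iota 1 N) p j = 1.
Implicit Types (mu : nat -> nat) (js : seq nat) (w : Omega).

Let measurable_preX k (B : set nat) : measurable (X k @^-1` B).
Proof. by rewrite -[X in measurable X]setTI; exact: measurable_funP. Qed.

(** The probabilities of the types sum to 1, so the values of draw k outside 1, ..., N form a null
    event. *)
Lemma probability_first_draw (A : set Omega) k : measurable A ->
  P A = (\sum_(j <- iota 1 N) P (A `&` X k @^-1` [set j]))%E.
Proof.
move=> mA.
have split_seq (B : set Omega) (r : seq nat) : measurable B -> uniq r ->
    P (B `&` X k @^-1` [set` r]) = (\sum_(j <- r) P (B `&` X k @^-1` [set j]))%E.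
  move=> mB; elim: r => [_|j r IHr /andP[jr ur]].
    rewrite big_nil (_ : _ `&` _ = set0) ?measure0//.
    by rewrite -subset0 => w [].
  rewrite big_cons -IHr// -measureU//.
  - congr (P _); rewrite -setIUr -preimage_setU; congr (_ `&` _ @^-1` _).
    apply/seteqP; split=> i /=; rewrite inE; first by move=> /orP[/eqP|]; [left|right].
    by move=> [->|->]; rewrite ?eqxx ?orbT.
  - exact: measurableI.
  - exact: measurableI.
  - rewrite -subset0 => w [[_ /= Xj] [_ /=]]; rewrite Xj => jr'.
    by rewrite jr' in jr.
rewrite -split_seq ?iota_uniq//.
rewrite -[in LHS](setIT A) -(setUv (X k @^-1` [set` iota 1 N])) setIUr.
have mB : measurable (X k @^-1` [set` iota 1 N]) by [].
rewrite measureU//; last 3 first.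
- exact: measurableI.
- by apply: measurableI => //; exact: measurableC.
- by rewrite setICA !setIA -setIA -setIA setICr !setI0.
rewrite [X in (_ + X)%E](_ : _ = 0%E) ?adde0//.
apply/eqP; rewrite eq_le measure_ge0 andbT.
apply: (@le_trans _ _ (P (~` (X k @^-1` [set` iota 1 N])))).
  by apply: le_measure; rewrite ?inE//; [apply: measurableI => //; exact: measurableC|exact: measurableC].
rewrite probability_setC// -[X k @^-1` _]setTI split_seq ?iota_uniq//.
rewrite (eq_big_seq (fun j => (p j)%:E)) ?sumEFin ?p_sum ?subee// => j.
by rewrite mem_iota add1n ltnS setTI; have [_] := draws; apply.
Qed.

Definition prefix_event js : set Omega :=
  [set w | forall i, (i < size js)%N -> X i w = nth 0%N js i].

Definition count_event k n mu : set Omega :=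
  [set w | all (fun j => mu j <= \sum_(i < n) (X (k + i) w == j))%N (iota 1 N)].

Let count_eventS k n mu j w : X k w = j ->
  count_event k n.+1 mu w <-> count_event k.+1 n (dec mu j) w.
Proof.
move=> Xj; rewrite /count_event /=.
suff -> : all (fun i => mu i <= \sum_(l < n.+1) (X (k + l) w == i))%N (iota 1 N) =
          all (fun i => dec mu j i <= \sum_(l < n) (X (k.+1 + l) w == i))%N (iota 1 N) by [].
apply: eq_all => i; rewrite big_ord_recl /= addn0 Xj /dec leq_subLR eq_sym.
by under eq_bigr do rewrite /bump /= addnS -addSn.
Qed.

Let count_event0 k mu : count_event k 0 mu =
  if all (fun j => mu j == 0)%N (iota 1 N) then setT else set0.
Proof.
have E w : all (fun j => mu j <= \sum_(i < 0) (X (k + i) w == j))%N (iota 1 N) =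
    all (fun j => mu j == 0)%N (iota 1 N).
  by apply: eq_all => j; rewrite big_ord0 leqn0.
by apply/seteqP; split=> w; rewrite /count_event /= E; case: (all _ _).
Qed.

Lemma measurable_count_event k n mu : measurable (count_event k n mu).
Proof.
elim: n k mu => [|n IHn] k mu.
  by rewrite count_event0; case: (all _ _).
have -> : count_event k n.+1 mu =
    \bigcup_j (X k @^-1` [set j] `&` count_event k.+1 n (dec mu j)).
  apply/seteqP; split=> [w hw|w [j _ [/= Xj]]]; last by move/(count_eventS n mu Xj).
  by exists (X k w) => //; split=> //; apply/(count_eventS n mu erefl).
by apply: bigcupT_measurable => j; apply: measurableI.
Qed.

Lemma measurable_prefix_event js : measurable (prefix_event js).
Proof.
have -> : prefix_event js = \bigcap_(i in [set` iota 0 (size js)]) (X i @^-1` [set nth 0%N js i]).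
  by apply/seteqP; split=> w h i /= hi; apply: h; move: hi; rewrite /= mem_iota.
by apply: bigcap_measurableType => i _.
Qed.

(** Fixing a prefix replaces conditioning: summing over the next draw lengthens the prefix and
    lowers the requirement. Independence enters only at n = 0, for the probability of the full
    prefix. *)
Lemma prefix_count_probability js n mu : {subset js <= iota 1 N} ->
  P (prefix_event js `&` count_event (size js) n mu) =
  (\prod_(j <- js) p j * fill_prob (iota 1 N) p n mu)%:E.
Proof.
have [indep marg] := draws.
elim: n js mu => [|n IHn] js mu jsN.
  have Pjs : P (prefix_event js) = (\prod_(j <- js) p j)%:E.
    have -> : prefix_event js =
       \bigcap_(i in [set` iota 0 (size js)]) (X i @^-1` [set nth 0%N js i]).
      by apply/seteqP; split=> w h i /= hi; apply: h; move: hi; rewrite /= mem_iota.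
    rewrite (indep (iota 0 (size js)) (fun i => [set nth 0%N js i]))//; last exact: iota_uniq.
    rewrite -[in RHS](mkseq_nth 0%N js) /mkseq big_map -prodEFin.
    apply: eq_big_seq => i; rewrite mem_iota => /andP[_ ijs].
    apply: marg; have := jsN (nth 0%N js i) (mem_nth 0%N ijs).
    by rewrite mem_iota add1n ltnS.
  rewrite count_event0 /=; case: (all _ _) => /=; first by rewrite setIT mulr1.
  by rewrite mulr0 setI0 measure0.
rewrite (@probability_first_draw _ (size js)); last first.
  by apply: measurableI; [exact: measurable_prefix_event|exact: measurable_count_event].
rewrite /= mulr_sumr -sumEFin; apply: eq_big_seq => j jN.
have -> : prefix_event js `&` count_event (size js) n.+1 mu `&` X (size js) @^-1` [set j] =
   prefix_event (rcons js j) `&` count_event (size (rcons js j)) n (dec mu j).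
  rewrite size_rcons; apply/seteqP; split=> w /=.
    move=> [[hp hc] Xj]; split; last exact/(count_eventS n mu Xj).
    move=> i; rewrite size_rcons ltnS leq_eqVlt nth_rcons => /orP[/eqP ->|ijs].
      by rewrite ltnn eqxx.
    by rewrite ijs hp.
  move=> [hp hc]; have Xj : X (size js) w = j.
    by rewrite (hp (size js)) ?size_rcons// nth_rcons ltnn eqxx.
  split=> //; split; last exact/(count_eventS n mu Xj).
  move=> i ijs; have := hp i; rewrite size_rcons nth_rcons ijs; apply.
  exact: ltnW.
rewrite IHn; last first.
  by move=> i; rewrite mem_rcons inE => /orP[/eqP -> //|]; exact: jsN.
by rewrite -cats1 big_cat big_seq1 mulrA.
Qed.

Variable m : nat.

Let complete_event n : set Omega := [set w | complete m N (fun k => X k w) n].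

Let complete_eventE n : complete_event n = count_event 0 n (fun=> m).
Proof. by []. Qed.

Let measurable_complete n : measurable (complete_event n).
Proof. by rewrite complete_eventE; exact: measurable_count_event. Qed.

Lemma complete_probability n :
  P (complete_event n) = (fill_prob (iota 1 N) p n (fun=> m))%:E.
Proof.
have := @prefix_count_probability [::] n (fun=> m).
rewrite big_nil mul1r => <-//; congr (P _).
by apply/seteqP; split=> [w hw|w []//]; split.
Qed.

Let complete_mono (x : nat -> nat) n n' : (n <= n')%N ->
  complete m N x n -> complete m N x n'.
Proof.
move=> nn'; apply: sub_all => j /leq_trans; apply.
by rewrite (big_ord_widen _ (fun k => (x k == j) : nat) nn') big_mkcond leq_sum// => i _; case: ifP.
Qed.

Let completion_timeP (x : nat -> nat) n : (exists k, complete m N x k) ->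
  (n < completion_time m N x)%N = ~~ complete m N x n.
Proof.
rewrite /completion_time; case: pselect => // h _.
case: ex_minnP => k ck kmin; apply/idP/idP => [nk|].
  by apply/negP => /kmin; rewrite leqNgt nk.
by apply: contraNT; rewrite -leqNgt => kn; exact: complete_mono ck.
Qed.

Let T w := completion_time m N (fun k => X k w).

Let a n : R := 1 - fill_prob (iota 1 N) p n (fun=> m).

Variables (I K : R).
Hypothesis sum_I : (\sum_(n <oo) (a n)%:E = I%:E)%E.
Hypothesis sum_K : (\sum_(n <oo) (a n * n.+1%:R)%:E = K%:E)%E.

Let a_ge0 n : 0 <= a n.
Proof. by rewrite subr_ge0; have /andP[] := fill_prob01 p_ge0 p_sum n (fun=> m). Qed.

Let eventually_complete : set Omega := \bigcup_n complete_event n.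

Let measurable_eventually : measurable eventually_complete.
Proof. exact: bigcupT_measurable. Qed.

Let incomplete_probability n : P (~` complete_event n) = (a n)%:E.
Proof. by rewrite probability_setC// complete_probability -EFinB. Qed.

Let a_cvg0 : a n @[n --> \oo] --> 0.
Proof.
have h : cvgn (series a).
  apply: nondecreasing_is_cvgn.
    by apply/nondecreasing_seqP => k; rewrite seriesSr lerDl.
  exists I => _ [k _ <-]; rewrite -lee_fin -sum_I -sumEFin.
  by apply: nneseries_lim_ge => n _ _; rewrite lee_fin.
exact: cvg_series_cvg_0.
Qed.

(** Never completing is contained in being incomplete after n draws, of probability a n, and a n
    tends to 0 because its series converges. *)
Let eventually_complete_ae : P (~` eventually_complete) = 0%E.
Proof.
apply/eqP; rewrite eq_le measure_ge0 andbT; apply/lee_addgt0Pr => e e0.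
rewrite add0e; have : \forall n \near \oo, a n <= e.
  by move/cvgrPdist_le: a_cvg0 => /(_ e e0); apply: filterS => n;
     rewrite sub0r normrN; apply: le_trans; exact: ler_norm.
move=> [n _ /(_ n (leqnn n)) /= ane].
apply: (@le_trans _ _ (P (~` complete_event n))); last by rewrite incomplete_probability lee_fin.
apply: le_measure; rewrite ?inE; [exact: measurableC|exact: measurableC|].
by apply: subsetC => w hw; exists n.
Qed.

(** Where the collection is never completed, T takes its default value 0 and lies in no tail event;
    the intersection accounts for this. *)
Let tail_event n : [set w | (n < T w)%N] = eventually_complete `&` ~` complete_event n.
Proof.
apply/seteqP; split=> w /=.
  move=> nT; have ex : exists k, complete m N (fun k => X k w) k.
    apply: contrapT => nex; move: nT; rewrite /T /completion_time.
    by case: pselect.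
  split; first by have [k ck] := ex; exists k.
  by apply/negP; rewrite -completion_timeP.
move=> [[k _ ck] nc]; rewrite /T completion_timeP; last by exists k.
exact/negP.
Qed.

Let measurable_tail n : measurable [set w | (n < T w)%N].
Proof. by rewrite tail_event; apply: measurableI => //; exact: measurableC. Qed.

Let tail_probability n : P [set w | (n < T w)%N] = (a n)%:E.
Proof.
rewrite tail_event -incomplete_probability.
have mC : measurable (~` complete_event n) by exact: measurableC.
have mE : measurable (~` eventually_complete) by exact: measurableC.
rewrite -[in RHS](setIT (~` _)) -(setUv eventually_complete) setIUr measureU//.
- rewrite setIC [X in (_ = _ + X)%E](_ : _ = 0%E) ?adde0//.
  apply/eqP; rewrite eq_le measure_ge0 andbT -eventually_complete_ae.
  by apply: le_measure; rewrite ?inE//; exact: measurableI.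
- exact: measurableI.
- exact: measurableI.
- by rewrite setIACA setICr setI0.
Qed.

Let indic_tail n w : \1_[set w | (n < T w)%N] w = (n < T w)%N%:R :> R.
Proof. by rewrite indicE; congr (nat_of_bool _)%:R; apply/idP/idP; rewrite inE. Qed.

Let measurable_indic_tail n :
  measurable_fun setT (\1_[set w | (n < T w)%N] : Omega -> R).
Proof. exact: measurable_indic (measurable_tail n). Qed.

(** Summation by layers: g = 1 yields E[T] and g n = 2 n + 1 yields E[T^2]. *)
Let integral_sum (g : nat -> R) : (forall n, 0 <= g n) ->
  (\int[P]_w (\sum_(n < T w) g n)%:E = \sum_(n <oo) (g n * a n)%:E)%E.
Proof.
move=> g0.
transitivity (\int[P]_w (\sum_(n <oo) (g n * \1_[set w | (n < T w)%N] w)%:E))%E.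
  apply: eq_integral => w _; apply/esym; apply: lim_near_cst => //.
  near=> K'.
  have TK : (T w <= K')%N by near: K'; exact: nbhs_infty_ge.
  rewrite sumEFin big_mkord (big_ord_widen _ g TK) [in RHS]big_mkcond/=; congr EFin.
  by apply: eq_bigr => n _; rewrite indic_tail; case: ifP; rewrite ?mulr1 ?mulr0.
rewrite integral_nneseries//; last 2 first.
- move=> n; apply/measurable_EFinP; apply: measurable_funM.
    exact: measurable_cst.
  exact: measurable_indic_tail.
- by move=> n w _; rewrite lee_fin mulr_ge0.
apply: eq_eseriesr => n _; under eq_integral do rewrite EFinM.
rewrite ge0_integralZl_EFin//=; last first.
  by apply/measurable_EFinP; exact: measurable_indic_tail.
by rewrite integral_indic//= ?setIT ?setTI; have -> := tail_probability n.
Unshelve. all: by end_near. Qed.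

Let measurable_T : measurable_fun setT (collector_time m N X).
Proof.
apply: (measurable_fun_cvg (h := fun K w => \sum_(n < K) \1_[set w | (n < T w)%N] w)).
  by move=> k; apply: measurable_sum => n; exact: measurable_indic_tail.
move=> w _; apply: (@cvg_near_cst _ R^o); near=> k.
have TK : (T w <= k)%N by near: k; exact: nbhs_infty_ge.
transitivity (\sum_(n < T w) (1 : R)); last by rewrite sumr_const card_ord.
rewrite (big_ord_widen _ (fun=> 1) TK) [in RHS]big_mkcond/=.
by apply: eq_bigr => n _; rewrite indic_tail; case: ifP.
Unshelve. all: by end_near. Qed.

Lemma collector_variance :
  'V_P[collector_time m N X]%E = (2 * K - I - I ^+ 2)%:E.
Proof.
have E1 : 'E_P[collector_time m N X]%E = I%:E.
  rewrite unlock -sum_I.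
  transitivity (\int[P]_w (\sum_(n < T w) (1 : R))%:E)%E.
    by apply: eq_integral => w _; rewrite sumr_const card_ord.
  rewrite (@integral_sum (fun=> 1))//.
  by apply: eq_eseriesr => n _; rewrite mul1r.
have E2 : 'E_P[collector_time m N X ^+ 2]%E = (2 * K - I)%:E.
  rewrite unlock.
  (* T^2 is the sum of the first T odd numbers. *)
  transitivity (\int[P]_w (\sum_(n < T w) (n.*2.+1%:R : R))%:E)%E.
    apply: eq_integral => w _; congr EFin; rewrite !fctE /collector_time -/(T w).
    elim: (T w) => [|k IHk]; first by rewrite big_ord0 expr0n.
    by rewrite big_ord_recr/= -IHk -addnn -!natr1 natrD; ring.
  rewrite (@integral_sum (fun n => n.*2.+1%:R))//.
  set Y := (\sum_(n <oo) _)%E.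
  have YI : (Y + I%:E = (2 * K)%:E)%E.
    rewrite -sum_I EFinM -sum_K -nneseriesZl; last by move=> n _; rewrite lee_fin mulr_ge0.
    rewrite -nneseriesD; last 2 first.
    - by move=> n _ _; rewrite lee_fin mulr_ge0.
    - by move=> n _ _; rewrite lee_fin.
    apply: eq_eseriesr => n _; rewrite -EFinD -EFinM; congr EFin.
    by rewrite -addnn -!natr1 natrD; ring.
  by rewrite EFinB -YI addeK.
have L2 : collector_time m N X \in Lfun P 2%:E.
  rewrite inE; apply/andP; split; rewrite inE//=.
  rewrite /finite_norm unlock poweR_lty//.
  under eq_integral do rewrite /= powR_mulrn// real_normK ?num_real//.
  by move: E2; rewrite unlock => ->; rewrite ltry.
by rewrite varianceE// E1 E2 expe2 -EFinM -EFinB expr2.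
Qed.

End coupon_probability.

(** * From the hypotheses on f to the asymptotics of the variance *)

Section conclusion.
Context {R : realType}.
Implicit Types (x y z : R) (N : nat).

Lemma bigmin_eq (r : seq nat) (F : nat -> R) (x : R) (i : nat) : i \in r ->
  F i <= x -> {in r, forall j, F i <= F j} ->
  \big[Num.min/x]_(j <- r) F j = F i.
Proof.
move=> ir Fx Fmin.
have lo (r' : seq nat) : {subset r' <= r} -> F i <= \big[Num.min/x]_(j <- r') F j.
  move=> rr'; elim: r' rr' => [|a r' IH] rr'; first by rewrite big_nil.
  rewrite big_cons le_min Fmin ?rr' ?mem_head//= IH// => j jr'.
  by apply: rr'; rewrite inE jr' orbT.
apply/eqP; rewrite eq_le lo// andbT.
elim: (r) ir => [//|a r' IH]; rewrite inE big_cons ge_min => /orP[/eqP ->|/IH ->].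
  by rewrite lexx.
by rewrite orbT.
Qed.

Variable f : R -> R.
Hypothesis f_C3 : C3_pos f.
Hypothesis f_gt0 : forall x : R, 0 < x -> 0 < f x.
Hypothesis f'_gt0 : forall x : R, 0 < x -> 0 < derive1n 1 f x.
Hypothesis f_ii : derive1n 1 f x / f x @[x --> +oo] --> (0 : R).
Hypothesis f_iii :
  (fun x : R => (derive1n 2 f x / derive1n 1 f x) / (derive1n 1 f x / f x) : R^o)
    =O_ (pinfty_filter R) (fun=> 1 : R^o).

Let is_derive_f x : 0 < x -> is_derive x 1 f (derive1n 1 f x).
Proof.
move=> x0; apply: DeriveDef; first exact: (f_C3.1 0%N x isT x0).
by rewrite derive1n1 derive1E.
Qed.

Let is_derive_f' x : 0 < x -> is_derive x 1 (derive1n 1 f) (derive1n 2 f x).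
Proof.
move=> x0; apply: DeriveDef; first exact: (f_C3.1 1%N x isT x0).
by rewrite (derive1nS f 1) derive1E.
Qed.

Let g x := f x / derive1n 1 f x.

(** The subtracted term is the quotient of (iii), so (iii) bounds the derivative of g near
    infinity. *)
Let is_derive_g x : 0 < x -> is_derive x 1 g
  (1 - (derive1n 2 f x / derive1n 1 f x) / (derive1n 1 f x / f x)).
Proof.
move=> x0; have f0 := f_gt0 x0; have f'0 := f'_gt0 x0.
have df := is_derive_f x0; have df' := is_derive_f' x0.
have dV : is_derive x 1 (fun t => (derive1n 1 f t)^-1)
    (- (derive1n 1 f x) ^- 2 * derive1n 2 f x).
  have dfx : derivable (derive1n 1 f) x 1 by exact: (f_C3.1 1%N x isT x0).
  have f'x : derive1n 1 f x != 0 by rewrite gt_eqF.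
  apply: DeriveDef; first exact: derivableV f'x dfx.
  by rewrite (deriveV f'x dfx) (@derive_val _ _ _ _ _ _ _ df').
have := is_deriveM df dV; rewrite /GRing.scale/= => /is_derive_eq; apply.
move: f0 f'0; rewrite !derive1n1.
move: (f x) (derive1 (derive1 f) x) (derive1 f x) => u w v u0 v0.
by field; rewrite !gt_eqF.
Qed.

(** The constant is rounded up to a natural number because it also serves as the exponent of f in
    [ratio_lower] and [ratio_upper]. *)
Let lipschitz_g : exists C n0 : nat, [/\ (0 < C)%N, (0 < n0)%N &
  forall y z, n0%:R <= y -> y <= z -> `|g z - g y| <= C%:R * (z - y)].
Proof.
have /eqO_exP[K K0 hK] := f_iii.
have [A [Areal hA]] := hK.
have hd x : A < x ->
    `|(derive1n 2 f x / derive1n 1 f x) / (derive1n 1 f x / f x)| <= K.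
  by move=> /hA /=; rewrite normr1 mulr1.
pose C := (Num.truncn (1 + K)).+1; pose n0 := (Num.truncn `|A|).+1.
have CK : 1 + K <= C%:R by rewrite /C ltW// truncnS_gt.
have n0A : A < n0%:R by rewrite (le_lt_trans (ler_norm _))// /n0 truncnS_gt.
have n00 : 0 < n0%:R :> R by rewrite ltr0n.
exists C, n0; split=> // y z n0y yz; clearbody C n0.
pose dg x := 1 - (derive1n 2 f x / derive1n 1 f x) / (derive1n 1 f x / f x).
have bound x : y <= x <= z -> 0 < x /\ `|dg x| <= C%:R.
  move=> /andP[yx xz]; have n0x : n0%:R <= x by exact: le_trans yx.
  split; first exact: lt_le_trans n0x.
  apply: le_trans (ler_normB _ _) _; rewrite normr1; apply: le_trans CK.
  by rewrite lerD2l hd// (lt_le_trans n0A).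
rewrite ler_norml; apply/andP; split.
  have h : C%:R * y + g y <= C%:R * z + g z.
    apply: (@derive_ge0_le _ ((fun t : R => C%:R * t) + g) (fun x => C%:R + dg x) _ _ yz).
      by move=> x /bound[x0 _]; exact: is_deriveD (is_derive_mull C%:R x) (is_derive_g x0).
    by move=> x /bound[_]; rewrite ler_norml => /andP[]; lra.
  by lra.
have h : C%:R * y - g y <= C%:R * z - g z.
  apply: (@derive_ge0_le _ ((fun t : R => C%:R * t) - g) (fun x => C%:R - dg x) _ _ yz).
    by move=> x /bound[x0 _]; exact: is_deriveB (is_derive_mull C%:R x) (is_derive_g x0).
  by move=> x /bound[_]; rewrite ler_norml => /andP[]; lra.
by lra.
Qed.

Let g_pinfty : g N%:R @[N --> \oo] --> +oo.
Proof.
have h : g x @[x --> +oo] --> +oo.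
  have -> : g = (fun x => (derive1n 1 f x / f x)^-1).
    by apply/funext => x; rewrite invfM invrK mulrC.
  apply/cvgrVy => //; near=> x.
  have x0 : 0 < x by near: x; exact: nbhs_pinfty_gt.
  by rewrite divr_gt0 ?f_gt0 ?f'_gt0.
exact: (cvg_comp _ _ (@cvgr_idn R) h).
Unshelve. all: by end_near. Qed.

Let weight_sum_gt0 N : (0 < N)%N -> 0 < weight_sum f N.
Proof.
case: N => // N _; rewrite /weight_sum big_nat_recl//= ltr_pwDl ?sumr_ge0//.
  by rewrite /weight invr_gt0 f_gt0.
by move=> i _; rewrite /weight invr_ge0 ltW// f_gt0 ?ltr0n.
Qed.

(** This is 1 / p_N, the unit of time in which p_j becomes r_j. *)
Let scale N : R := weight_sum f N * f N%:R.

Let scale_gt0 N : (0 < N)%N -> 0 < scale N.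
Proof. by move=> N0; rewrite mulr_gt0 ?weight_sum_gt0// f_gt0 ?ltr0n. Qed.

Let coupon_prob_gt0 N j : (0 < N)%N -> j \in iota 1 N -> 0 < coupon_prob f N j.
Proof.
move=> N0; rewrite mem_iota => /andP[j0 _].
by rewrite divr_gt0 ?weight_sum_gt0// invr_gt0 f_gt0 ?ltr0n.
Qed.

Let coupon_prob_sum N : (0 < N)%N -> \sum_(j <- iota 1 N) coupon_prob f N j = 1.
Proof.
move=> N0; rewrite -mulr_suml /weight_sum /index_iota subn1/= divff//.
by have := weight_sum_gt0 N0; rewrite /weight_sum /index_iota subn1/= => /gt_eqF ->.
Qed.

Let scale_coupon_prob N j : (0 < N)%N ->
  scale N * coupon_prob f N j = f N%:R / f j%:R.
Proof.
move=> N0; have A0 : weight_sum f N != 0 by rewrite gt_eqF ?weight_sum_gt0.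
rewrite /scale /coupon_prob /weight; move: (weight_sum f N) A0 => A A0.
by rewrite [A * _]mulrC [_ / A]mulrC -mulrA mulVKf.
Qed.

Let ratios_rev N : ratios f N = rev [seq f N%:R / f j%:R | j <- iota 1 N].
Proof.
apply: (@eq_from_nth _ 0); rewrite ?size_rev ?size_map ?size_iota// => i iN.
rewrite nth_rev ?size_map ?size_iota// !(nth_map 0%N) ?size_iota//; last first.
  by rewrite subnSK ?leq_subr.
rewrite !nth_iota// ?subnSK ?leq_subr// add0n add1n.
by rewrite subnSK.
Qed.

Let max_cdf_coupon m N x : (0 < N)%N ->
  max_cdf m [seq scale N * coupon_prob f N j | j <- iota 1 N] x = max_cdf m (ratios f N) x.
Proof.
move=> N0; rewrite /max_cdf; apply: perm_big; rewrite ratios_rev perm_sym perm_rev.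
by rewrite (eq_map (fun j => scale_coupon_prob j N0)).
Qed.

Let scale_ge N : (0 < N)%N -> N%:R <= scale N.
Proof.
move=> N0; rewrite /scale mulr_suml /index_iota subn1/=.
rewrite -[leLHS](mulr1 N%:R) mulr_natl -{1}(size_iota 1 N) -count_predT.
rewrite -[1 *+ _]iter_addr_0 -big_const_seq big_seq [leRHS]big_seq.
apply: ler_sum => j; rewrite mem_iota add1n ltnS => /andP[j0 jN].
have fj : 0 < f j%:R by rewrite f_gt0 ?ltr0n.
rewrite /weight mulrC ler_pdivlMr// mul1r.
by apply: (le_f f'_gt0 is_derive_f); rewrite ?ltr0n ?ler_nat.
Qed.

Lemma variance_asymptotics (m : nat) (d : nat -> measure_display)
  (Omega : forall N, measurableType (d N)) (P : forall N, probability (Omega N) R)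
  (X : forall N, nat -> {RV (P N) >-> nat})
  (draws : forall N, (0 < N)%N -> coupon_draws N (coupon_prob f N) (X N)) :
  asymptotic_to (fun N => 'V_(P N)[collector_time m.+1 N (X N)]%E)
    (fun N => pi ^+ 2 / 6 * weight_sum f N ^+ 2 * f N%:R ^+ 2).
Proof.
have [C [n0 [C0 n00 g_lip]]] := lipschitz_g.
have rs1 N := @ratios_ge1 R f (derive1n 1 f) f_gt0 f'_gt0 is_derive_f N.
have /choice[c hc] : forall N, exists c : R, (0 < N)%N ->
    0 <= c /\ lt_sum m.+1 (ratios f N) c = 1.
  case=> [|N]; first by exists 0.
  have [c c0 cE] := @exists_center R f (derive1n 1 f) f_gt0 f'_gt0 is_derive_f m N.+1 isT.
  by exists c.
have c_oo := center_pinfty f_gt0 f'_gt0 is_derive_f n00 C0 g_lip g_pinfty hc.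
have cN0 := center_div_cvg0 f_gt0 f'_gt0 is_derive_f n00 C0 g_lip g_pinfty hc.
have c_sum x := @center_lt_sum_cvg R f (derive1n 1 f) n0 C f_gt0 f'_gt0 is_derive_f n00 C0
  g_lip g_pinfty m c x hc.
(* [moments_cvg] wants centres that are at least 1 at every index, so all sequences are shifted by
   N1; N1 > 0 also discards the empty collection. *)
have [N1 N10 cN1] : exists2 N1, (0 < N1)%N & forall N, (N1 <= N)%N -> 1 <= c N.
  have /cvgryPge /(_ 1) [N1 _ hN1] := c_oo.
  exists N1.+1 => // N /ltnW; exact: hN1.
have int_fin N := integrable_onem_max_cdf m (rs1 N).
pose M1 N := fine (\int[lebesgue_measure]_(s in `[0%R, +oo[)
  (1 - max_cdf m.+1 (ratios f N) s)%:E)%E.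
pose M2 N := fine (\int[lebesgue_measure]_(s in `[0%R, +oo[)
  (s * (1 - max_cdf m.+1 (ratios f N) s))%:E)%E.
have M1E N : (\int[lebesgue_measure]_(s in `[0%R, +oo[)
    (1 - max_cdf m.+1 (ratios f N) s)%:E = (M1 N)%:E)%E.
  by rewrite fineK//; apply: integrable_fin_num => //; exact: (int_fin N).1.
have M2E N : (\int[lebesgue_measure]_(s in `[0%R, +oo[)
    (s * (1 - max_cdf m.+1 (ratios f N) s))%:E = (M2 N)%:E)%E.
  by rewrite fineK//; apply: integrable_fin_num => //; exact: (int_fin N).2.
have NN1 n : (0 < n + N1)%N by rewrite addn_gt0 N10 orbT.
have shift (u : nat -> R) (F : set_system R) :
    u N @[N --> \oo] --> F -> u (n + N1)%N @[n --> \oo] --> F.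
  by move=> uF; exact: (cvg_comp _ _ (cvg_addnr N1) uF).
have [l1 l2] := @moments_cvg R m (fun n => ratios f (n + N1)) (fun n => c (n + N1)%N)
  (fun n => M1 (n + N1)%N) (fun n => M2 (n + N1)%N)
  (fun n => @rs1 (n + N1)%N) (fun n => cN1 _ (leq_addl n N1))
  (fun n => (hc _ (NN1 n)).2) (shift _ _ c_oo) (fun x => shift _ _ (c_sum x))
  (fun n => M1E _) (fun n => M2E _).
rewrite gumbel_variance in l2.
have var N : (0 < N)%N -> 'V_(P N)[collector_time m.+1 N (X N)]%E =
    (scale N ^+ 2 * (2 * M2 N - M1 N ^+ 2 - M1 N / scale N))%:E.
  move=> N0; have b0 := scale_gt0 N0.
  have p0 : {in iota 1 N, forall j, 0 <= coupon_prob f N j}.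
    by move=> j jN; exact/ltW/coupon_prob_gt0.
  have p1 := coupon_prob_sum N0.
  have a0 n : 0 <= 1 - fill_prob (iota 1 N) (coupon_prob f N) n (fun=> m.+1).
    by rewrite subr_ge0; have /andP[] := fill_prob01 p0 p1 n (fun=> m.+1).
  have e1 := integral_onem_max_cdf m.+1 (iota_uniq 1 N) p0 p1 b0.
  have e2 := integral_id_onem_max_cdf m.+1 (iota_uniq 1 N) p0 p1 b0.
  rewrite (@collector_variance _ _ _ _ _ _ _ (draws N N0) p0 p1 m.+1
    (scale N * M1 N) (scale N ^+ 2 * M2 N)); last 2 first.
  - rewrite EFinM -M1E; under eq_integral do rewrite -max_cdf_coupon//.
    rewrite e1 -nneseriesZl; last by move=> n _; rewrite lee_fin divr_ge0// ltW.
    by apply: eq_eseriesr => n _; rewrite -EFinM mulrCA divff ?mulr1// gt_eqF.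
  - rewrite EFinM -M2E; under eq_integral do rewrite -max_cdf_coupon//.
    rewrite e2 -nneseriesZl; last first.
      by move=> n _; rewrite lee_fin; apply: divr_ge0; [apply: mulr_ge0; [exact: a0|exact: ler0n]|exact: sqr_ge0].
    apply: eq_eseriesr => n _; rewrite -EFinM mulrCA divff ?mulr1//.
    by rewrite expf_neq0// gt_eqF.
  by congr EFin; field; rewrite gt_eqF.
have V0 : (scale (n + N1))^-1 @[n --> \oo] --> (0 : R).
  have hN : (n + N1)%:R^-1 @[n --> \oo] --> (0 : R).
    have h := (cvg_comp _ _ (cvg_addnr N1) (@cvgr_idn R)).
    by apply/gtr0_cvgV0 => //; apply: nearW => n; rewrite ltr0n.
  apply: (@squeeze_cvgr _ _ _ _ (fun=> 0) (fun n => (n + N1)%:R^-1)) hN.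
    apply: nearW => n; rewrite invr_ge0 (ltW (scale_gt0 (NN1 n)))/=.
    by rewrite lef_pV2 ?posrE ?scale_gt0 ?ltr0n// scale_ge.
  exact: cvg_cst.
have cV0 : c (n + N1)%N / scale (n + N1) @[n --> \oo] --> (0 : R).
  apply: (@squeeze_cvgr _ _ _ _ (fun=> 0) (fun n => c (n + N1)%N / (n + N1)%:R)) (shift _ _ cN0).
    apply: nearW => n; have [cn0 _] := hc _ (NN1 n).
    rewrite divr_ge0 ?(ltW (scale_gt0 (NN1 n)))//= ler_wpM2l//.
    by rewrite lef_pV2 ?posrE ?scale_gt0 ?ltr0n// scale_ge.
  exact: cvg_cst.
(* M1 itself diverges; it is split into M1 - c, which converges, and c, which is negligible against
   the scale. *)
have M1V : M1 (n + N1)%N / scale (n + N1) @[n --> \oo] --> (0 : R).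
  have h : (M1 (n + N1)%N - c (n + N1)%N) * (scale (n + N1))^-1 +
      c (n + N1)%N / scale (n + N1) @[n --> \oo] --> (0 : R).
    have := cvgD (cvgM l1 V0) cV0; rewrite mulr0 addr0; exact.
  apply: cvg_trans h; apply: near_eq_cvg; apply: nearW => n.
  by rewrite -mulrDl subrK.
have W := cvgB l2 M1V; rewrite subr0 in W.
have pi6 : (pi ^+ 2 / 6 : R) != 0 by rewrite gt_eqF// divr_gt0 ?exprn_gt0 ?pi_gt0.
have W1 : (2 * M2 (n + N1)%N - M1 (n + N1)%N ^+ 2 - M1 (n + N1)%N / scale (n + N1)) /
    (pi ^+ 2 / 6) @[n --> \oo] --> (1 : R).
  by rewrite -[X in _ --> X](divff pi6); apply: cvgMl; exact: W.
rewrite /asymptotic_to -(cvg_shiftn N1).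
have W2 : ((2 * M2 (n + N1)%N - M1 (n + N1)%N ^+ 2 - M1 (n + N1)%N / scale (n + N1)) /
    (pi ^+ 2 / 6))%:E @[n --> \oo] --> (1%:E : \bar R).
  by apply: cvg_EFin; [exact: nearW|exact: W1].
apply: cvg_trans W2; apply: near_eq_cvg; apply: nearW => n /=.
rewrite var// -EFinM; congr EFin.
have b0 : scale (n + N1) != 0 by rewrite gt_eqF ?scale_gt0.
have -> : pi ^+ 2 / 6 * weight_sum f (n + N1) ^+ 2 * f (n + N1)%:R ^+ 2 =
   pi ^+ 2 / 6 * scale (n + N1) ^+ 2 by rewrite /scale exprMn [RHS]mulrA.
move: pi6 b0; move: (pi ^+ 2 / 6) (scale _) => u v u0 v0.
by field; rewrite u0 v0.
Qed.

Lemma min_prob_coupon N : (0 < N)%N ->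
  min_prob N (coupon_prob f N) = coupon_prob f N N.
Proof.
move=> N0; have A0 := weight_sum_gt0 N0.
have le_p j : (0 < j <= N)%N -> coupon_prob f N N <= coupon_prob f N j.
  move=> /andP[j0 jN]; rewrite ler_pM2r ?invr_gt0// lef_pV2 ?posrE ?f_gt0 ?ltr0n//.
  by apply: (le_f f'_gt0 is_derive_f); rewrite ?ltr0n ?ler_nat.
rewrite /min_prob; apply: bigmin_eq; rewrite ?mem_index_iota ?N0 ?ltnS ?leqnn//.
  exact: le_p.
by move=> j; rewrite mem_index_iota ltnS; exact: le_p.
Qed.

Lemma coupon_prob_last N : (0 < N)%N ->
  1 / coupon_prob f N N ^+ 2 = weight_sum f N ^+ 2 * f N%:R ^+ 2.
Proof.
move=> N0; have A0 := weight_sum_gt0 N0.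
have fN : 0 < f N%:R by rewrite f_gt0 ?ltr0n.
by rewrite /coupon_prob /weight; field; rewrite !gt_eqF.
Qed.

End conclusion.

Theorem theorem2p5 (R : realType) (f : R -> R)
  (f_C3 : C3_pos f)
  (f_gt0 : forall x : R, 0 < x -> 0 < f x)
  (f'_gt0 : forall x : R, 0 < x -> 0 < derive1n 1 f x)
  (f_i : f x @[x --> +oo] --> +oo)
  (f_ii : derive1n 1 f x / f x @[x --> +oo] --> (0 : R))
  (f_iii : (fun x : R => (derive1n 2 f x / derive1n 1 f x) / (derive1n 1 f x / f x) : R^o)
             =O_ (pinfty_filter R) (fun=> 1 : R^o))
  (f_iv : (fun x : R => derive1n 3 f x * f x ^+ 2 / (derive1n 1 f x) ^+ 3 : R^o)
             =O_ (pinfty_filter R) (fun=> 1 : R^o))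
  (m : nat) (m_gt0 : (0 < m)%N)
  (d : nat -> measure_display)
  (Omega : forall N, measurableType (d N))
  (P : forall N, probability (Omega N) R)
  (X : forall N, nat -> {RV (P N) >-> nat})
  (draws : forall N, (0 < N)%N -> coupon_draws N (coupon_prob f N) (X N)) :
  asymptotic_to (fun N => 'V_(P N)[collector_time m N (X N)]%E)
    (fun N => pi ^+ 2 / 6 * weight_sum f N ^+ 2 * f N%:R ^+ 2) /\
  (forall N, (0 < N)%N ->
     pi ^+ 2 / 6 * weight_sum f N ^+ 2 * f N%:R ^+ 2 =
       pi ^+ 2 / 6 * (1 / coupon_prob f N N ^+ 2) /\
     pi ^+ 2 / 6 * (1 / coupon_prob f N N ^+ 2) =
       pi ^+ 2 / 6 * (1 / min_prob N (coupon_prob f N) ^+ 2)).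
Proof.
case: m m_gt0 => // m _; split.
  exact: (variance_asymptotics f_C3 f_gt0 f'_gt0 f_ii f_iii m draws).
move=> N N0; rewrite (min_prob_coupon f_C3 f_gt0 f'_gt0 N0).
by rewrite (coupon_prob_last f_gt0 N0) mulrA.
Qed.
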